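(* There is an absolute constant $C>0$ such that the following holds. Let $n\ge1$ be an integer and let $u,w$ be real with $1\le u\le \frac{n}{10}$ and $1\le w\le \frac{n}{10}$; put $v=n+w-u$. Let $U_1,\ldots,U_n$ be independent uniform-$[0,1]$ random variables with empirical distribution function $F_n(t)=\frac1n\#\{i:U_i\le t\}$, and let $$Q_n(u,v)=\mathbf{P}\Big(F_n(t)\le \frac{vt+u}{n}\ \text{ for all } 0\le t\le 1\Big).$$ For integers $m\ge1$ define $f_m(x)=\frac{(m-x)^{m-1}}{e^{m-x}(m-1)!}$ for $x\le m$ and $f_m(x)=0$ for $x>m$. Let $b=b(n+1,w)$ be the unique real number with $0\le b\le w$ and $f_{n+1}(1-w)=f_{n+1}(1+w-b)$. Then $$\Big|\,Q_n(u,v)-1+\Big(1-\frac{u(2w-b)}{(n-w+b)(n+w-u)}\Big)^{n}\Big|\le C\Big(\frac{u+w}{n}+\frac{uw^2}{n^2}\Big)e^{-\frac{uw}{n+w-u}}.$$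
   Context: The function $f_m$ is the probability density of $X_1+\cdots+X_m$, where the $X_i$ are independent with density $e^{x-1}$ for $x\le1$ and $0$ for $x>1$. Existence and uniqueness of $b(m,z)\in[0,z]$ with $f_m(1-z)=f_m(1+z-b)$ holds for every integer $m\ge 2$ and real $z\ge0$. *)

(* Defs.v *)
From HB Require Import structures.
From mathcomp Require Import all_boot all_order all_algebra.
From mathcomp Require Import all_classical all_reals all_analysis.
From Stdlib Require Import Rdefinitions.
From mathcomp Require Import Rstruct Rstruct_topology.
Set Implicit Arguments. Unset Strict Implicit. Unset Printing Implicit Defensive.
Import Order.TTheory GRing.Theory Num.Theory.
Local Open Scope classical_set_scope.
Local Open Scope ring_scope.

Definition fm (m : nat) (x : R) : R :=
  if x <= m%:R then (m%:R - x) ^+ m.-1 / (expR (m%:R - x) * (m.-1)`!%:R)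
  else 0.

Definition mutually_independent d (T : measurableType d) (P : probability T R)
  (n : nat) (X : 'I_n -> T -> R) : Prop :=
  forall (J : {set 'I_n}) (A : 'I_n -> set R),
    (forall i, @measurable _ (measurableTypeR R) (A i)) ->
    P (\bigcap_(i in [set j | j \in J]) (X i @^-1` A i)) =
    (\prod_(i in J) P (X i @^-1` A i))%E.

Definition uniform01 d (T : measurableType d) (P : probability T R)
  (X : T -> R) : Prop :=
  forall A : set R, @measurable _ (measurableTypeR R) A ->
    P (X @^-1` A) = (@lebesgue_measure R) (A `&` `[0, 1]).

Definition empirical_cdf d (T : measurableType d) (n : nat)
  (X : 'I_n -> T -> R) (x : T) (t : R) : R :=
  #|[set i : 'I_n | X i x <= t]|%:R / n%:R.

Definition Qn d (T : measurableType d) (P : probability T R) (n : nat)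
  (X : 'I_n -> T -> R) (u v : R) : R :=
  fine (P [set x | forall t : R, 0 <= t <= 1 ->
                     empirical_cdf X x t <= (v * t + u) / n%:R]).

Arguments fm m x%ring_scope.
Arguments Qn [d T] P [n] X u%ring_scope v%ring_scope.

(* Main.v *)
Require Import Defs.
From HB Require Import structures.
From mathcomp Require Import all_boot all_order all_algebra.
From mathcomp Require Import all_classical all_reals all_analysis.
From Stdlib Require Import Rdefinitions.
From mathcomp Require Import Rstruct Rstruct_topology.
From mathcomp Require Import ssrnat exp ring lra.
Import Order.TTheory GRing.Theory Num.Theory.
Local Open Scope ring_scope.

(** Rescale time by [v], read it backwards and cut it into cells of length [h].
    The normalised numbers [Dk k m] of good ways to put [m] points into the last
    [k] cells obey a linear recursion, killed as soon as [k * h > m + w].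
    Without the boundary the recursion is solved by every shift
    [q_(m + l)(t)], where [q_p(t) = t^p / p!] (binomial theorem), so one can
    reflect in the number of points instead of in space: for an integer [L] close
    to [2 * w] and a normalisation [kap L], the function
    [q_m - kap L * q_(m + L)] almost vanishes along the boundary.  Its boundary
    values are dominated by a combination of [q_(m + L)] and of first and second
    differences of [l |-> kap l * q_(m + l)] at [L - 2], which solves the same
    recursion; a comparison principle carries the domination to the end point,
    where the ratio of consecutive [kap l * q_(n + l)] is exactly
    [r = v / (n + w + 1)].  Letting the mesh go to 0 gives [Qn] close to
    [1 - r ^ L].  Finally [r ^ L] is close to the power in the statement by
    elementary bounds on logarithms, which only need [b <= w ^ 2 / n]; the latter
    says that the logarithmic mean of [n + w] and [n - w + b], which equals [n],
    is at least their geometric mean. *)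

(** * Comparison principle *)

Definition qp (R : realType) (p : nat) (t : R) : R := t ^+ p / p`!%:R.

(** The value 0 for [p < s] plays the role of q at a negative index and keeps the convolution
    identity [qs_add] valid. Indexing by p = m + L lets m itself run below 0. *)
Definition qs (R : realType) (s p : nat) (t : R) : R :=
  if (s <= p)%N then qp R (p - s) t else 0.

Lemma qp_add (R : realType) (p : nat) (t h : R) :
  qp R p (t + h) = \sum_(j < p.+1) qp R j h * qp R (p - j) t.
Proof.
rewrite /qp exprDn mulr_suml; apply: eq_bigr => j _.
have jp : (j <= p)%N by rewrite -ltnS ltn_ord.
have fu (k : nat) : k`!%:R != 0 :> R by rewrite pnatr_eq0 -lt0n fact_gt0.
have -> : (p`!%:R : R) = 'C(p, j)%:R * (j`!%:R * (p - j)`!%:R).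
  by rewrite -!natrM bin_fact.
have bu : ('C(p, j)%:R : R) != 0 by rewrite pnatr_eq0 -lt0n bin_gt0.
rewrite -[_ *+ 'C(_, _)]mulr_natr.
by field; rewrite !fu bu.
Qed.

Lemma qs_add (R : realType) (s p : nat) (t h : R) :
  qs R s p (t + h) = \sum_(j < p.+1) qp R j h * qs R s (p - j) t.
Proof.
rewrite /qs; case: (leqP s p) => sp; last first.
  rewrite big1 // => j _; case: leqP; rewrite ?mulr0 // => /leq_trans.
  by move=> /(_ _ (leq_subr _ _)); rewrite leqNgt sp.
rewrite qp_add (big_ord_widen_cond p.+1 xpredT (fun j => qp R j h * qp R (p - s - j) t));
  last by rewrite ltnS leq_subr.
rewrite big_mkcond /=; apply: eq_bigr => j _; rewrite ltnS.
have jp : (j <= p)%N by rewrite -ltnS ltn_ord.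
rewrite leq_subRL // addnC -leq_subRL //; case: ifP => _; last by rewrite mulr0.
by rewrite subnAC.
Qed.

Section Comparison.
Variables (R : realType) (P : nat) (h Bd : R) (f M : nat -> nat -> R).
Variables (rel good : nat -> nat -> bool) (N : nat).
Hypotheses (h0 : 0 < h) (h1 : h <= 1) (Bd0 : 0 <= Bd).
Hypothesis f0 : forall p, (p <= P)%N -> rel 0 p -> `|f 0 p| <= M 0 p.
Hypothesis fbad : forall k p, (k < N)%N -> (p <= P)%N -> rel k.+1 p -> ~~ good k.+1 p ->
  `|f k.+1 p| <= M k.+1 p.
Hypothesis fgood : forall k p, (k < N)%N -> (p <= P)%N -> good k.+1 p ->
  [/\ rel k p, (0 < p)%N -> rel k p.-1 &
      f k.+1 p = \sum_(j < p.+1) qp R j h * f k (p - j)].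
Hypothesis Msum : forall k p, M k.+1 p = \sum_(j < p.+1) qp R j h * M k (p - j).
Hypothesis fB : forall k p, (k <= N)%N -> (p <= P)%N -> `|f k p| <= Bd.
Hypothesis MB : forall k p, (k <= N)%N -> (p <= P)%N -> `|M k p| <= Bd.

Let K := 2 * Bd * P%:R.

Lemma qp_le_sqr j : (2 <= j)%N -> qp R j h <= h ^+ 2.
Proof.
move=> j2; rewrite /qp ler_pdivrMr ?ltr0n ?fact_gt0 //.
have h20 : 0 <= h ^+ 2 by rewrite exprn_ge0 // ltW.
apply: (@le_trans _ _ (h ^+ 2)); last by rewrite ler_peMr // ler1n fact_gt0.
by rewrite ler_wiXn2l // ltW.
Qed.

(** Induction on k. At a good point [rel] is only inherited by p and p - 1, so the induction
    hypothesis serves the terms j = 0 and j = 1. The remaining terms, fewer than P in number, carry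
    [qp R j h <= h ^+ 2] and are bounded crudely by [2 * Bd * h ^+ 2]. The error therefore obeys T'
    = (1 + h) T + K h^2, whose solution from 0 is the stated one. *)
Lemma comparison k p : (k <= N)%N -> (p <= P)%N -> rel k p ->
  `|f k p| <= M k p + K * h * ((1 + h) ^+ k - 1).
Proof.
have K0 : 0 <= K by rewrite !mulr_ge0.
have qp0 j : 0 <= qp R j h by rewrite divr_ge0 // exprn_ge0 // ltW.
elim: k p => [|k IH] p kN pP rkp.
  by rewrite expr0 subrr mulr0 addr0; apply: f0.
set T := K * h * ((1 + h) ^+ k - 1) in IH.
have T0 : 0 <= T.
  rewrite !mulr_ge0 //; first exact: ltW.
  by rewrite subr_ge0 exprn_ege1 // lerDl ltW.
have TS : K * h * ((1 + h) ^+ k.+1 - 1) = (1 + h) * T + K * h ^+ 2.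
  by rewrite /T exprS; ring.
rewrite TS.
case: (boolP (good k.+1 p)) => gkp; last first.
  apply: (le_trans (fbad _ _ kN pP rkp gkp)).
  by rewrite lerDl addr_ge0 // mulr_ge0 // ?exprn_ge0 ?addr_ge0 // ltW.
have [r0 r1 ->] := fgood _ _ kN pP gkp.
have kN' := ltnW kN.
rewrite Msum.
apply: (le_trans (ler_norm_sum _ _ _)).
pose e j : R := if j == 0%N then T else if j == 1%N then h * T else 2 * Bd * h ^+ 2.
apply: (@le_trans _ _ (\sum_(j < p.+1) (qp R j h * M k (p - j) + e j))).
  apply: ler_sum => j _; rewrite normrM ger0_norm //.
  have jp : (j <= p)%N by rewrite -ltnS ltn_ord.
  have pjP : (p - j <= P)%N by exact: leq_trans (leq_subr _ _) pP.
  rewrite /e; case: eqP => [->|j0].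
    rewrite /qp expr0 fact0 divr1 !mul1r subn0.
    exact: IH.
  case: eqP => [j1|j1].
    rewrite j1 /qp expr1 divr1 -mulrDr; apply: ler_wpM2l; first exact: ltW.
    rewrite subn1; apply: IH => //; first by rewrite -subn1 -j1.
    by apply: r1; rewrite -j1 in jp *; rewrite (leq_trans _ jp) // j1.
  have j2 : (2 <= j)%N by case: (nat_of_ord j) j0 j1 => [|[]].
  have := qp_le_sqr _ j2; have := fB _ _ kN' pjP; have := MB _ _ kN' pjP.
  have := qp0 j; move: (qp R j h) (f k _) (M k _) => q a b q0.
  rewrite ler_norml => /andP[b1 b2] ab qh.
  have : q * Bd <= h ^+ 2 * Bd by apply: ler_wpM2r.
  have : q * `|a| <= q * Bd by apply: ler_wpM2l.
  have : q * (- Bd) <= q * b by apply: ler_wpM2l.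
  by lra.
rewrite big_split /= lerD2l.
have Bh : 0 <= 2 * Bd * h ^+ 2 by rewrite !mulr_ge0 // ?exprn_ge0 // ltW.
have hT : 0 <= h * T by rewrite mulr_ge0 // ltW.
case: p pP {rkp gkp r0 r1} => [|p] pP.
  rewrite big_ord1 /e /=.
  have : 0 <= K * h ^+ 2 by rewrite mulr_ge0 // exprn_ge0 // ltW.
  by lra.
have -> : \sum_(j < p.+2) e j = T + (h * T + (2 * Bd * h ^+ 2) * p%:R).
  rewrite big_ord_recl big_ord_recl /e /=; congr (_ + (_ + _)).
  by rewrite sumr_const card_ord mulr_natr.
have : (p%:R : R) <= P%:R by rewrite ler_nat ltnW.
by move=> /(ler_wpM2l Bh); rewrite /K; lra.
Qed.

End Comparison.

(** * Ratios of consecutive terms *)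

Ltac pos := first [ assumption | by [] |
  lazymatch goal with
  | |- is_true (@Order.le _ _ _ (@GRing.mul _ _ _)) => apply: mulr_ge0; pos
  | |- is_true (@Order.lt _ _ _ (@GRing.mul _ _ _)) => apply: mulr_gt0; pos
  | |- is_true (@Order.le _ _ _ (@GRing.inv _ _)) => rewrite invr_ge0; pos
  | |- is_true (@Order.lt _ _ _ (@GRing.inv _ _)) => rewrite invr_gt0; pos
  | |- is_true (@Order.le _ _ _ (@GRing.exp _ _ _)) => apply: exprn_ge0; pos
  | |- is_true (@Order.lt _ _ _ (@GRing.exp _ _ _)) => apply: exprn_gt0; pos
  | |- _ => lra
  end ].

Ltac clear_bool := repeat match goal with H : is_true _ |- _ => clear H end.

Lemma prod_le_expR (R : realType) (L : nat) (r : nat -> R) :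
  (forall i, (i < L)%N -> 0 <= r i) ->
  \prod_(i < L) r i <= expR (\sum_(i < L) (r i - 1)).
Proof.
elim: L => [|L IH] r0; first by rewrite !big_ord0 expR0.
rewrite !big_ord_recr /= expRD ler_pM //.
- by apply: prodr_ge0 => i _; apply: r0; rewrite ltnS ltnW.
- exact: r0.
- by apply: IH => i iL; apply: r0; rewrite ltnS ltnW.
by have := expR_ge1Dx (r L - 1); lra.
Qed.

Lemma expR_sub1_le (R : realType) (y : R) : expR y - 1 <= y * expR y.
Proof.
have := expR_ge1Dx (- y); move=> /(ler_wpM2l (expR_ge0 y)).
by rewrite -expRD subrr expR0; lra.
Qed.

Lemma sum_succn (R : realType) (L : nat) :
  \sum_(i < L) (i.+1%:R : R) = L%:R * (L%:R + 1) / 2.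
Proof.
elim: L => [|L IH]; first by rewrite big_ord0 !mul0r.
by rewrite big_ord_recr /= IH -natr1; field.
Qed.

(* The ratio of consecutive terms of l |-> kap l * qp (m + l) t. *)
Definition rho (R : realType) (n a w t i : R) : R :=
  t * (n + i) / ((n + w + 1) * (a + i)).

Lemma rho_gt0 (R : realType) (n a w t i : R) :
  0 <= a -> a <= n -> 0 <= w -> 0 < t -> 1 <= i -> 0 < rho R n a w t i.
Proof. by move=> ? ? ? ? ?; rewrite /rho divr_gt0 // !mulr_gt0 //; lra. Qed.

(** At t = a + w + 1 the numerator of rho - 1 is exactly (n - a)(w + 1 - i). Replacing the
    denominator a + i by a + w + 1 costs (w + 1 - i)^2, at most 36 w^2, and leaves a main part
    antisymmetric about i = w + 1. *)
Lemma rho_sub1_le (R : realType) (n a w t i : R) :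
  0 <= a -> a <= n -> 1 <= w -> 1 <= i -> i <= 2 * w + 6 -> t <= a + w + 1 ->
  rho R n a w t i - 1 <=
  (n - a) / (n + w + 1) * ((w + 1 - i) + 36 * w ^+ 2 / (a + 1)) / (a + w + 1).
Proof.
move=> a0 an w1 i1 ile tle.
have G0 : 0 < n + w + 1 by lra.
have ai0 : 0 < a + i by lra.
have ni0 : 0 < n + i by lra.
have az0 : 0 < a + w + 1 by lra.
have a1 : 0 < a + 1 by lra.
apply: (@le_trans _ _ ((n - a) * (w + 1 - i) / ((n + w + 1) * (a + i)))).
  have -> : rho R n a w t i - 1 =
      (t * (n + i) - (n + w + 1) * (a + i)) / ((n + w + 1) * (a + i)).
    by rewrite /rho; field; rewrite !gt_eqF.
  rewrite ler_pM2r ?invr_gt0 ?mulr_gt0 //.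
  have : t * (n + i) <= (a + w + 1) * (n + i) by rewrite ler_pM2r.
  by clear_bool; lra.
have -> : (n - a) * (w + 1 - i) / ((n + w + 1) * (a + i)) =
   (n - a) / (n + w + 1) * ((w + 1 - i) / (a + i)) by field; rewrite !gt_eqF.
rewrite -[X in _ <= X]mulrA; apply: ler_wpM2l.
  by rewrite divr_ge0 ?subr_ge0 // ltW.
rewrite ler_pdivrMr //; set Y := w + 1 - i + _.
rewrite [Y / _ * _]mulrAC ler_pdivlMr // /Y.
have h : (w + 1 - i) ^+ 2 <= 36 * w ^+ 2.
  have h1 : 0 <= (6 * w - (w + 1 - i)) * (6 * w + (w + 1 - i)).
    by apply: mulr_ge0; move: w1 i1 ile; clear; lra.
  by move: h1; clear; lra.
have w20 : 0 <= w ^+ 2 by exact: sqr_ge0.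
have y0 : 0 <= 36 * w ^+ 2 / (a + 1).
  by apply: divr_ge0; [exact: mulr_ge0 | exact: ltW].
have e : 36 * w ^+ 2 / (a + 1) * (a + 1) = 36 * w ^+ 2 by field; rewrite gt_eqF.
have h2 : 0 <= 36 * w ^+ 2 / (a + 1) * (i - 1) by apply: mulr_ge0; rewrite ?subr_ge0.
by move: h h2 e; clear; lra.
Qed.

(** Replacing n + i by n + w + 1 under i - (w + 1) only increases the quotient, whatever the sign of
    i - (w + 1). *)
Lemma rhoV_sub1_le (R : realType) (n a w t i : R) :
  0 <= a -> a <= n -> 1 <= w -> 0 < t -> 1 <= i ->
  a + w + 1 - t <= 3 / 2 ->
  (rho R n a w t i)^-1 - 1 <= ((n - a) / (n + w + 1) * (i - (w + 1)) + 3 / 2) / t.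
Proof.
move=> a0 an w1 t0 i1 ht.
have G0 : 0 < n + w + 1 by lra.
have ai0 : 0 < a + i by lra.
have ni0 : 0 < n + i by lra.
have -> : (rho R n a w t i)^-1 - 1 =
   ((n - a) * (i - (w + 1)) / (n + i) + (a + w + 1 - t)) / t.
  by rewrite /rho; field; rewrite !gt_eqF.
rewrite ler_pM2r ?invr_gt0 //; apply: lerD => //.
rewrite -!mulrA; apply: ler_wpM2l; first by rewrite subr_ge0.
rewrite ler_pdivrMr // -mulrA ler_pdivlMl //.
by have := sqr_ge0 (i - (w + 1)); clear_bool; lra.
Qed.

(** * Products of the ratios over the window i = 1, ..., L *)

Section Window.
Variables (R : realType) (n a w t : R) (L : nat).

Let x := w / (a + w).
Let mu := 1 - a / n.
Let RR := \prod_(i < L) rho R n a w t i.+1%:R.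

(** With S the sum of the rho - 1, RR <= e^S gives RR (1 - S) <= RR e^(-S) <= 1, hence RR - 1 <= RR
    S. The linear parts of the ratios cancel over the window, so S is at most of order w mu x^2. *)
Lemma window_upper : 0 <= a -> a <= n -> 1 <= w -> w <= n / 10 ->
  2 * w + 5 <= L%:R -> L%:R <= 2 * w + 6 -> 0 < t -> t <= a + w + 1 ->
  RR - 1 <= 1000 * RR * (x + w * mu * x ^+ 2).
Proof.
move=> a0 an w1 wn Lge Lle t0 tle.
have w0 : 0 <= w by lra.
have aw : 0 < a + w by lra.
have n0 : 0 < n by lra.
have G0 : 0 < n + w + 1 by lra.
have az0 : 0 < a + w + 1 by lra.
have a1 : 0 < a + 1 by lra.
have iL i : (i < L)%N -> 1 <= i.+1%:R :> R /\ (i.+1%:R : R) <= 2 * w + 6.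
  by move=> il; split; rewrite ?ler1n // (le_trans _ Lle) // ler_nat.
have rp i : (i < L)%N -> 0 < rho R n a w t i.+1%:R.
  by move=> /iL[i1 _]; exact: rho_gt0.
have RR0 : 0 < RR by apply: prodr_gt0 => i _; apply: rp.
have x0 : 0 <= x by apply: divr_ge0 => //; exact: ltW.
have mu0 : 0 <= mu by rewrite subr_ge0 ler_pdivrMr ?mul1r.
have wmx : 0 <= w * mu * x ^+ 2.
  by apply: mulr_ge0; [exact: mulr_ge0 | exact: exprn_ge0].
have RRw : 0 <= RR * (w * mu * x ^+ 2) by apply: mulr_ge0; [exact: ltW|].
have RRx : 0 <= RR * x by apply: mulr_ge0; [exact: ltW|].
(* For w > a one has x >= 1/2, and already RR <= 2 RR x suffices. *)
case: (lerP w a) => wa; last first.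
  have x2 : 1 / 2 <= x by rewrite /x ler_pdivlMr //; move: wa; clear_bool; lra.
  have : 0 <= RR * (x - 1 / 2) by apply: mulr_ge0; [exact: ltW | rewrite subr_ge0].
  by move: RR0 RRw; clear_bool; lra.
set S := \sum_(i < L) (rho R n a w t i.+1%:R - 1).
have RS : RR <= expR S.
  by apply: (prod_le_expR _ _ (fun i => rho R n a w t i.+1%:R)) => i /rp /ltW.
have R1S : RR * (1 - S) <= 1.
  apply: (@le_trans _ _ (RR * expR (- S))).
    by rewrite ler_pM2l //; have := expR_ge1Dx (- S); clear_bool; lra.
  by rewrite -(@ler_pM2r _ (expR S)) ?expR_gt0 // -mulrA -expRD addNr expR0 mulr1 mul1r.
suff Sle : S <= 1000 * (w * mu * x ^+ 2).
  have : RR * S <= RR * (1000 * (w * mu * x ^+ 2)) by apply: ler_wpM2l => //; exact: ltW.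
  by move: R1S RRx; clear_bool; lra.
pose m' := (n - a) / (n + w + 1).
have m'0 : 0 <= m' by apply: divr_ge0; [rewrite subr_ge0 | exact: ltW].
have m'mu : m' <= mu.
  have -> : mu = (n - a) / n by rewrite /mu; field; rewrite gt_eqF.
  apply: ler_wpM2l; first by rewrite subr_ge0.
  by rewrite lef_pV2 ?posrE //; move: w0; clear_bool; lra.
have : S <= \sum_(i < L) m' * ((w + 1 - i.+1%:R) + 36 * w ^+ 2 / (a + 1)) / (a + w + 1).
  by apply: ler_sum => i _; have [i1 i2] := iL _ (ltn_ord i); apply: rho_sub1_le.
move=> /le_trans; apply.
rewrite -mulr_suml -mulr_sumr big_split /= sumr_const card_ord sumrB sumr_const card_ord.
rewrite sum_succn -[(w + 1) *+ L]mulr_natr -[X in _ + X]mulr_natr.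
have w20 : 0 <= 36 * w ^+ 2 by apply: mulr_ge0 => //; exact: exprn_ge0.
set q := 36 * w ^+ 2 / (a + 1).
have q0 : 0 <= q by apply: divr_ge0 => //; exact: ltW.
(* Since L >= 2w + 5, the sum of w + 1 - i over the window is L (2w + 1 - L) / 2 <= 0; only the
   quadratic correction q survives. *)
have step1 : (w + 1) * L%:R - L%:R * (L%:R + 1) / 2 + q * L%:R <= 8 * w * q.
  have h1 : 0 <= L%:R * (L%:R - (2 * w + 5)) by rewrite mulr_ge0 // subr_ge0.
  have h2 : q * L%:R <= q * (8 * w).
    by apply: ler_wpM2l => //; move: Lle w1; clear_bool; lra.
  have h3 : 0 <= L%:R :> R by [].
  by move: h1 h2 h3; clear_bool; lra.
apply: (@le_trans _ _ (m' * (8 * w * q) / (a + w + 1))).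
  by apply: ler_wpM2r; [rewrite invr_ge0 ltW | apply: ler_wpM2l].
have wq0 : 0 <= 8 * w * q by apply: mulr_ge0 => //; exact: mulr_ge0.
apply: (@le_trans _ _ (mu * (8 * w * (36 * w ^+ 2 / ((a + w) / 2))) / (a + w))).
  apply: ler_pM; rewrite ?invr_ge0 ?(ltW az0) //; first exact: mulr_ge0.
    apply: ler_pM => //; apply: ler_wpM2l; first exact: mulr_ge0.
    apply: ler_wpM2l => //.
    rewrite lef_pV2 ?posrE ?divr_gt0 //; move: wa; clear_bool; lra.
  by rewrite lef_pV2 ?posrE // lerDl.
have -> : mu * (8 * w * (36 * w ^+ 2 / ((a + w) / 2))) / (a + w) = 576 * (w * mu * x ^+ 2).
  by rewrite /x; field; rewrite gt_eqF.
by apply: ler_wpM2r => //; clear_bool; lra.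
Qed.

(** The same argument for the inverse ratios: 1 - RR = RR (1/RR - 1), and the inverse product is at
    most e^(64 x) with x <= 1. Here the linear parts contribute O(w), which after division by t is
    of order x. *)
Lemma window_lower : 0 <= a -> a <= n -> 1 <= w ->
  L%:R <= 2 * w + 6 -> 2 * w + 5 <= L%:R -> 0 < t -> a + w - 1 / 2 <= t ->
  1 - RR <= 64 * expR 64 * RR * x.
Proof.
move=> a0 an w1 Lle Lge t0 tge.
have w0 : 0 <= w by lra.
have aw : 0 < a + w by lra.
have G0 : 0 < n + w + 1 by lra.
have rp i : (i < L)%N -> 0 < rho R n a w t i.+1%:R.
  by move=> il; apply: rho_gt0 => //; rewrite ler1n.
have RR0 : 0 < RR by apply: prodr_gt0 => i _; apply: rp.
have x0 : 0 <= x by apply: divr_ge0 => //; exact: ltW.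
have x1 : x <= 1 by rewrite ler_pdivrMr ?mul1r // lerDr.
have RV : RR^-1 = \prod_(i < L) (rho R n a w t i.+1%:R)^-1.
  by rewrite /RR (big_morph _ (@invfM _) (invr1 _)).
have RVle : RR^-1 <= expR (64 * x).
  rewrite RV.
  apply: (le_trans (prod_le_expR _ _ (fun i => (rho R n a w t i.+1%:R)^-1) _)).
    by move=> i /rp ?; rewrite invr_ge0 ltW.
  rewrite ler_expR.
  pose m' := (n - a) / (n + w + 1).
  have m'0 : 0 <= m' by apply: divr_ge0; [rewrite subr_ge0 | exact: ltW].
  have m'1 : m' <= 1 by rewrite ler_pdivrMr ?mul1r //; move: a0 w0; clear_bool; lra.
  apply: (@le_trans _ _ (\sum_(i < L) (m' * (i.+1%:R - (w + 1)) + 3 / 2) / t)).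
    apply: ler_sum => i _; apply: rhoV_sub1_le => //; first by rewrite ler1n.
    by move: tge; clear_bool; lra.
  rewrite -mulr_suml big_split /= sumr_const card_ord -mulr_sumr sumrB sumr_const card_ord.
  rewrite sum_succn -[(w + 1) *+ L]mulr_natr -[X in _ + X]mulr_natr.
  have -> : L%:R * (L%:R + 1) / 2 - (w + 1) * L%:R = L%:R * ((L%:R + 1) / 2 - (w + 1)) by ring.
  have L0 : 0 <= L%:R :> R by [].
  have q0 : 0 <= (L%:R + 1) / 2 - (w + 1) by move: Lge w0; clear_bool; lra.
  have b1 : L%:R * ((L%:R + 1) / 2 - (w + 1)) <= 8 * w * (5 / 2).
    by apply: ler_pM => //; move: Lle w1; clear_bool; lra.
  have b3 : m' * (L%:R * ((L%:R + 1) / 2 - (w + 1))) <= 8 * w * (5 / 2).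
    by rewrite (le_trans _ b1) // ler_piMl // mulr_ge0.
  apply: (@le_trans _ _ (32 * w / t)).
    by apply: ler_wpM2r; [rewrite invr_ge0 ltW | move: b3 Lle w1; clear_bool; lra].
  have -> : 64 * x = 64 * w / (a + w) by rewrite /x; field; rewrite gt_eqF.
  rewrite ler_pdivrMr // [_ / _ * t]mulrAC ler_pdivlMr //.
  have : 0 <= w * (2 * t - (a + w)).
    by apply: mulr_ge0 => //; move: tge a0 w1; clear_bool; lra.
  by clear_bool; lra.
have h := expR_sub1_le _ (64 * x).
have e64 : expR (64 * x) <= expR 64 by rewrite ler_expR; move: x1; clear_bool; lra.
have R1 : 1 - RR = RR * (RR^-1 - 1) by rewrite mulrBr mulfV ?gt_eqF // mulr1.
have -> : 64 * expR 64 * RR * x = RR * (64 * x * expR 64) by ring.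
rewrite R1; apply: ler_wpM2l; first exact: ltW.
have : 64 * x * expR (64 * x) <= 64 * x * expR 64 by apply: ler_wpM2l => //; exact: mulr_ge0.
by move: h RVle; clear_bool; lra.
Qed.

Lemma window_abs : 0 <= a -> a <= n -> 1 <= w -> w <= n / 10 ->
  2 * w + 5 <= L%:R -> L%:R <= 2 * w + 6 -> a + w - 1 / 2 <= t -> t <= a + w + 1 ->
  `|1 - RR| <= 1000 * expR 64 * RR * (x + w * mu * x ^+ 2).
Proof.
move=> a0 an w1 wn Lge Lle tge tle.
have t0 : 0 < t by lra.
have w0 : 0 <= w by lra.
have aw : 0 < a + w by lra.
have n0 : 0 < n by lra.
have RR0 : 0 <= RR.
  by apply: prodr_ge0 => i _; apply: ltW; apply: rho_gt0 => //; rewrite ler1n.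
have x0 : 0 <= x by apply: divr_ge0 => //; exact: ltW.
have mu0 : 0 <= mu by rewrite subr_ge0 ler_pdivrMr ?mul1r.
have wmx : 0 <= w * mu * x ^+ 2.
  by apply: mulr_ge0; [exact: mulr_ge0 | exact: exprn_ge0].
have e1 : 1 <= expR 64 :> R by rewrite -expR0 ler_expR.
have hu := window_upper a0 an w1 wn Lge Lle t0 tle.
have hl := window_lower a0 an w1 Lle Lge t0 tge.
have q0 : 0 <= RR * x by exact: mulr_ge0.
have q1 : 0 <= RR * (w * mu * x ^+ 2) by exact: mulr_ge0.
move: q0 q1 e1 hu hl; rewrite ler_norml.
have -> : 1000 * RR * (x + w * mu * x ^+ 2) = 1000 * (RR * x + RR * (w * mu * x ^+ 2)) by ring.
have -> : 64 * expR 64 * RR * x = 64 * (expR 64 * (RR * x)) by ring.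
have -> : 1000 * expR 64 * RR * (x + w * mu * x ^+ 2) =
  1000 * (expR 64 * (RR * x) + expR 64 * (RR * (w * mu * x ^+ 2))) by ring.
move: (RR * x) (RR * (w * mu * x ^+ 2)) (expR 64) => p q e p0 q0 e1 hu hl.
have ep := ler_wpM2r p0 e1; have eq := ler_wpM2r q0 e1.
by apply/andP; split; move: ep eq p0 q0 hu hl; clear_bool; lra.
Qed.

End Window.

(* Here [a] is the index [m] of [q_m], which may be negative, and [k] is [L - 2]. *)
Section Majorant.
Variables (R : realType) (n a w t k : R).
Hypotheses (w0 : 0 <= w) (n0 : 0 < n) (an : a <= n) (kw : 2 * w + 3 <= k).
Hypotheses (ak : 0 <= a + k) (t0 : 0 <= t) (tle : t <= a + w + 1).

Let r1 := rho R n a w t (k + 1).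
Let r2 := rho R n a w t (k + 2).
Let d := 1 - r1.

Let G0 : 0 < n + w + 1. Proof. by rewrite ltr_wpDl ?addr_ge0 // ltW. Qed.
Let hA : 0 < a + (k + 1). Proof. by rewrite addrA ltr_wpDl. Qed.
Let hB : 0 < a + (k + 2). Proof. by rewrite addrA ltr_wpDl. Qed.
Let k0 : 0 <= k. Proof. by move: w0 kw => ? ?; lra. Qed.
Let kmw : w <= k - w. Proof. by move: kw => ?; lra. Qed.

(** Equality holds at t = a + w + 1, and d decreases in t. *)
Lemma defect_ge : (n - a) * (k - w) / ((n + w + 1) * (a + (k + 1))) <= d.
Proof.
have -> : d = ((n + w + 1) * (a + (k + 1)) - t * (n + (k + 1))) / ((n + w + 1) * (a + (k + 1))).
  by rewrite /d /r1 /rho; field; rewrite !gt_eqF.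
apply: ler_wpM2r; first by rewrite invr_ge0 mulr_ge0 // ltW.
have : t * (n + (k + 1)) <= (a + w + 1) * (n + (k + 1)).
  by apply: ler_wpM2r => //; rewrite !addr_ge0 // ltW.
by lra.
Qed.

Lemma defect_ge0 : 0 <= d.
Proof.
apply: (le_trans _ defect_ge); apply: divr_ge0; last by rewrite mulr_ge0 // ltW.
by apply: mulr_ge0; [rewrite subr_ge0 | exact: le_trans kmw].
Qed.

Lemma rho12E : r1 - r2 =
  t / (a + (k + 2)) * ((n - a) / ((n + w + 1) * (a + (k + 1)))).
Proof. by rewrite /r1 /r2 /rho; field; rewrite !gt_eqF. Qed.

Lemma rho2_le : 0 <= r2 /\ r2 <= r1.
Proof.
split.
  by apply: divr_ge0; apply: mulr_ge0 => //; [rewrite !addr_ge0 // ltW | exact: ltW | exact: ltW].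
rewrite -subr_ge0 rho12E; apply: mulr_ge0; first by rewrite divr_ge0 // ltW.
by rewrite divr_ge0 ?subr_ge0 // mulr_ge0 // ltW.
Qed.

(** The second difference is 1 - 2 r1 + r1 r2 = d^2 - r1 (r1 - r2). Its negative part, multiplied by
    w, is at most d, because w <= k - w and t <= a + k + 2; the coefficient 2 in front of 1 - r1
    holds one d in reserve for it. *)
Lemma majorant_factor_ge :
  w / n + (1 + w ^+ 2 / n) * d + w * d ^+ 2 <=
  w / n + (2 + w ^+ 2 / n) * (1 - r1) + w * (1 - 2 * r1 + r1 * r2).
Proof.
have [r20 r21] := rho2_le.
have r10 : 0 <= r1 by exact: le_trans r21.
have r1_1 : r1 <= 1 by rewrite -subr_ge0 defect_ge0.
have r120 : 0 <= r1 - r2 by rewrite subr_ge0.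
have r12 : w * (r1 - r2) <= d.
  apply: (le_trans _ defect_ge); rewrite rho12E mulrA.
  have -> : (n - a) * (k - w) / ((n + w + 1) * (a + (k + 1))) =
     (k - w) * ((n - a) / ((n + w + 1) * (a + (k + 1)))) by field; rewrite !gt_eqF.
  apply: ler_wpM2r; first by rewrite divr_ge0 ?subr_ge0 // mulr_ge0 // ltW.
  rewrite mulrA ler_pdivrMr //; apply: ler_pM => //.
  by move: tle w0 kw => ? ? ?; lra.
have : r1 * (w * (r1 - r2)) <= d.
  by rewrite (le_trans _ r12) // ler_piMl // mulr_ge0.
by rewrite /d; lra.
Qed.

End Majorant.

(** * Domination on the boundary *)

(** The numerators n + i cancel the a + i of [rho] when a = n, so that at the end point all ratios
    coincide. *)
Definition kap (R : realType) (n w : R) (l : nat) : R :=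
  \prod_(i < l) ((n + i.+1%:R) / (n + w + 1)).

(** With p = m + K + 2 and g l = kap l * q_(m + l), this is w/n * g K + (2 + w^2/n) * (g K - g
    (K+1)) + w * (g K - 2 g (K+1) + g (K+2)), expanded so that linearity in the functions [qs] is
    visible. *)
Definition major (R : realType) (n w : R) (K p : nat) (t : R) : R :=
  (w / n + (2 + w ^+ 2 / n) + w) * kap R n w K * qs R 2 p t
  - ((2 + w ^+ 2 / n) + 2 * w) * kap R n w K.+1 * qs R 1 p t
  + w * kap R n w K.+2 * qs R 0 p t.

Lemma qp_ge0 (R : realType) (p : nat) (t : R) : 0 <= t -> 0 <= qp R p t.
Proof. by move=> t0; rewrite /qp; pos. Qed.

Lemma qpS (R : realType) (p : nat) (t : R) : qp R p.+1 t = qp R p t * (t / p.+1%:R).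
Proof.
have fp : p`!%:R != 0 :> R by rewrite pnatr_eq0 -lt0n fact_gt0.
have sp : p.+1%:R != 0 :> R by rewrite pnatr_eq0.
rewrite /qp exprSr factS natrM; move: fp sp; move: (p.+1%:R) (p`!%:R) => x y y0 x0.
by field; rewrite x0.
Qed.

Lemma kap_ge0 (R : realType) (n w : R) (l : nat) : 0 <= n -> 0 <= w -> 0 <= kap R n w l.
Proof.
move=> n0 w0; apply: prodr_ge0 => i _.
have : 0 <= (i.+1%:R : R) by []. move=> ?.
by pos.
Qed.

Lemma kapS (R : realType) (n w : R) (l : nat) :
  kap R n w l.+1 = kap R n w l * ((n + l.+1%:R) / (n + w + 1)).
Proof. by rewrite /kap big_ord_recr. Qed.

Lemma kap_qpS (R : realType) (n w t : R) (l p : nat) : 0 <= n -> 0 <= w ->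
  kap R n w l.+1 * qp R p.+1 t = kap R n w l * qp R p t * rho R n (p%:R - l%:R) w t l.+1%:R.
Proof.
move=> n0 w0; rewrite kapS qpS /rho -!natr1.
have : 0 <= (p%:R : R) by []. have : 0 <= (l%:R : R) by []. move=> ? ?.
by field; lra.
Qed.

Lemma kap_qp_prod (R : realType) (n w t : R) (l m : nat) : 0 <= n -> 0 <= w ->
  kap R n w l * qp R (m + l) t = qp R m t * \prod_(i < l) rho R n m%:R w t i.+1%:R.
Proof.
move=> n0 w0; elim: l => [|l IH]; first by rewrite /kap !big_ord0 addn0 mul1r mulr1.
rewrite addnS kap_qpS // IH big_ord_recr /= mulrA.
by rewrite natrD addrK.
Qed.

Lemma majorE (R : realType) (n w t : R) (K p : nat) : 0 <= n -> 0 <= w ->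
  let r1 := rho R n (p%:R - K%:R) w t (K%:R + 1) in
  let r2 := rho R n (p%:R - K%:R) w t (K%:R + 2) in
  major R n w K p.+2 t = kap R n w K * qp R p t *
    (w / n + (2 + w ^+ 2 / n) * (1 - r1) + w * (1 - 2 * r1 + r1 * r2)).
Proof.
move=> n0 w0 r1 r2.
have E1 : kap R n w K.+1 * qp R p.+1 t = kap R n w K * qp R p t * r1.
  by rewrite kap_qpS // -natr1.
have E2 : kap R n w K.+2 * qp R p.+2 t = kap R n w K * qp R p t * r1 * r2.
  rewrite kap_qpS // E1 /r2; congr (_ * rho _ _ _ _ _ _); rewrite -!natr1; ring.
rewrite /major /qs /= !subSS !subn0.
rewrite -(mulrA _ (kap _ _ _ K)) -(mulrA _ (kap _ _ _ K.+1)) -(mulrA _ (kap _ _ _ K.+2)) E1 E2.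
by move: E1 E2 => _ _; clearbody r1 r2; ring.
Qed.

(** Converts the error of the window product into the weights of the majorant. With s = w/n, x =
    w/(a + w) and mu = 1 - a/n one has s + mu x - x = s x >= 0, so a factor x may be traded for s +
    mu x, while mu x <= 10 d by hypothesis. *)
Lemma factor_lower (R : realType) (n a w d : R) :
  0 <= a -> a <= n -> 1 <= w -> 0 < n -> (1 - a / n) * (w / (a + w)) / 10 <= d ->
  w / (a + w) + w * (1 - a / n) * (w / (a + w)) ^+ 2 <=
  100 * (w / n + (1 + w ^+ 2 / n) * d + w * d ^+ 2).
Proof.
move=> a0 an w1 n0.
have xE : w / (a + w) <= w / n + (1 - a / n) * (w / (a + w)).
  rewrite -subr_ge0.
  have -> : w / n + (1 - a / n) * (w / (a + w)) - w / (a + w) = w / n * (w / (a + w)).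
    by field; lra.
  by pos.
have s0 : 0 <= w / n by pos.
have x0 : 0 <= w / (a + w) by pos.
have mu0 : 0 <= 1 - a / n by rewrite subr_ge0 ler_pdivrMr ?mul1r.
have -> : w ^+ 2 / n = w * (w / n) by ring.
move: xE s0 x0 mu0; move: (w / n) (w / (a + w)) (1 - a / n) => s x mu xE s0 x0 mu0 dge.
have mx0 : 0 <= mu * x by pos.
have h1 : w * (mu * x * x) <= w * (mu * x * (s + mu * x)).
  by apply: ler_wpM2l; [lra | apply: ler_wpM2l].
have h2 : w * (s * (mu * x / 10)) <= w * (s * d).
  by apply: ler_wpM2l; [lra | apply: ler_wpM2l].
have h3 : w * ((mu * x / 10) * (mu * x / 10)) <= w * (d * d).
  by apply: ler_wpM2l; [lra | apply: ler_pM => //; lra].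
have h4 : 0 <= w * (s * (mu * x)) by pos.
by lra.
Qed.

Lemma defect_bound_lower (R : realType) (n a w k : R) :
  0 <= a -> a <= n -> 1 <= w -> w <= n / 10 -> 2 * w + 3 <= k -> k <= 2 * w + 4 ->
  (1 - a / n) * (w / (a + w)) / 10 <= (n - a) * (k - w) / ((n + w + 1) * (a + (k + 1))).
Proof.
move=> a0 an w1 wn kge kle.
have n0 : 0 < n by lra.
have w0 : 0 <= w by lra.
have aw : 0 < a + w by lra.
have G0 : 0 < n + w + 1 by lra.
have ak : 0 < a + (k + 1) by lra.
have -> : (1 - a / n) * (w / (a + w)) / 10 = (n - a) * (w / (10 * n * (a + w))).
  by field; rewrite !gt_eqF.
rewrite -[X in _ <= X]mulrA; apply: ler_wpM2l; first by rewrite subr_ge0.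
rewrite ler_pdivrMr ?mulr_gt0 // [_ / _ * _]mulrAC ler_pdivlMr ?mulr_gt0 //.
have : w * (12 / 10 * n * (8 * (a + w))) <= (k - w) * (10 * n * (a + w)).
  have na0 : 0 <= n * (a + w) by rewrite mulr_ge0 // ltW.
  have : 0 <= (k - 2 * w) * (n * (a + w)).
    by apply: mulr_ge0 => //; move: kge; clear_bool; lra.
  by have := mulr_ge0 w0 na0; clear_bool; lra.
apply: le_trans; apply: ler_wpM2l => //.
apply: ler_pM; rewrite ?(ltW G0) ?(ltW ak) //; first by move: w1 wn; clear_bool; lra.
by move: kle a0 w1; clear_bool; lra.
Qed.

(** Write L = K + 2 and m = p - L. For m >= 0 the left side is q_m |1 - RR|, controlled by
    [window_abs] and then [factor_lower]. For m < 0 the term q_m is absent and the defect d is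
    bounded below by a constant. *)
Lemma boundary (R : realType) (n K : nat) (w : R) (p : nat) (t : R) :
  1 <= w -> w <= n%:R / 10 -> 2 * w + 3 <= K%:R -> K%:R <= 2 * w + 4 ->
  (p <= n + K.+2)%N -> 0 <= t ->
  t <= p%:R - K.+2%:R + w + 1 ->
  ((K.+2 <= p)%N -> p%:R - K.+2%:R + w - 1 / 2 <= t) ->
  `|kap R n%:R w K.+2 * qs R 0 p t - qs R K.+2 p t| <=
  100 * (1000 * expR 64) * major R n%:R w K p t.
Proof.
move=> w1 wn kge kle pP t0 tle tge; pose nR : R := n%:R.
rewrite -/nR in wn *.
have e1 : 1 <= expR 64 :> R by rewrite -expR0 ler_expR.
have [c [c1 cE]] : exists c : R, 1 <= c /\ c = 1000 * expR 64.
  by exists (1000 * expR 64); split => //; move: e1; clear; lra.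
rewrite -cE.
have n0 : 0 < nR by lra.
have w0 : 0 <= w by lra.
have K2 : K.+2%:R = K%:R + 2 :> R by rewrite -addn2 natrD.
(* The bounds 0 <= t <= p - L + w + 1 exclude p = 0 and p = 1. *)
have [p' pE] : exists p', p = p'.+2.
  rewrite K2 in tle; case: p {pP tge} tle => [|[|p']] tle; try by exfalso; lra.
  by exists p'.
move: pP tle tge; rewrite pE => pP tle tge.
pose a : R := p'%:R - K%:R.
have aE : (p'.+2%:R - K.+2%:R : R) = a by rewrite /a -!natr1; ring.
rewrite aE in tle tge.
have an : a <= nR.
  rewrite /a lerBlDr -natrD ler_nat.
  by move: pP; rewrite !addnS !ltnS.
have ak : 0 <= a + K%:R by rewrite /a subrK.
have n0' : 0 <= nR by exact: ltW.
set r1 := rho R nR a w t (K%:R + 1).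
set r2 := rho R nR a w t (K%:R + 2).
have d0 : 0 <= 1 - r1 by exact: defect_ge0.
have [r20 r21] : 0 <= r2 /\ r2 <= r1 by exact: rho2_le.
have r1_1 : r1 <= 1 by rewrite -subr_ge0.
have r12_1 : r1 * r2 <= 1.
  by rewrite -[1]mulr1; apply: ler_pM => //; [exact: le_trans r21 | exact: le_trans r1_1].
have B0 : 0 <= kap R nR w K * qp R p' t.
  by apply: mulr_ge0; [exact: kap_ge0 | exact: qp_ge0].
(* The reflected term is the base term of the majorant times two ratios, both at most 1. *)
have BL : kap R nR w K.+2 * qp R p'.+2 t <= kap R nR w K * qp R p' t.
  have -> : kap R nR w K.+2 * qp R p'.+2 t = kap R nR w K * qp R p' t * (r1 * r2).
    rewrite !kap_qpS // -mulrA.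
    by rewrite /r1 /r2 /a -!natr1; congr (_ * (rho _ _ _ _ _ _ * rho _ _ _ _ _ _)); ring.
  by rewrite ler_piMr.
have fge := majorant_factor_ge _ _ _ _ _ _ w0 n0 an kge ak t0 tle.
have dge : (nR - a) * (K%:R - w) / ((nR + w + 1) * (a + (K%:R + 1))) <= 1 - r1.
  exact: defect_ge.
rewrite -/r1 -/r2 in fge.
have ME := majorE R nR w t K p' n0' w0.
rewrite -/a -/r1 -/r2 /= in ME.
set F := w / nR + (2 + w ^+ 2 / nR) * (1 - r1) + w * (1 - 2 * r1 + r1 * r2) in fge ME.
rewrite ME.
set x0 := kap R nR w K * qp R p' t in B0 BL ME *.
have c0 : 0 <= c by exact: le_trans c1.
rewrite {1}/qs /= subn0 /qs !ltnS; case: (leqP K p') => Kp.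
  pose m := (p' - K)%N.
  have am : a = m%:R by rewrite /a /m natrB.
  have mE : (p'.+2 - K.+2 = m)%N by rewrite !subSS.
  have pm : p'.+2 = (m + K.+2)%N by rewrite /m !addnS subnK.
  have a0 : 0 <= a by rewrite am.
  have Lge : 2 * w + 5 <= K.+2%:R by rewrite K2; move: kge; clear; lra.
  have Lle : K.+2%:R <= 2 * w + 6 by rewrite K2; move: kle; clear; lra.
  have tge' : a + w - 1 / 2 <= t by apply: tge; rewrite !ltnS.
  have W := window_abs _ _ _ _ _ _ a0 an w1 wn Lge Lle tge' tle.
  have Q0 := qp_ge0 _ m _ t0.
  rewrite -cE in W.
  set PR := \prod_(i < K.+2) rho R nR a w t i.+1%:R in W.
  have qE : kap R nR w K.+2 * qp R p'.+2 t = qp R m t * PR.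
    by rewrite pm kap_qp_prod // /PR am.
  rewrite mE qE.
  rewrite qE in BL.
  have -> : qp R m t * PR - qp R m t = - (qp R m t * (1 - PR)) by ring.
  rewrite normrN normrM ger0_norm //.
  have mu0 : 0 <= 1 - a / nR by rewrite subr_ge0 ler_pdivrMr ?mul1r.
  have aw0 : 0 <= w / (a + w) by apply: divr_ge0 => //; exact: addr_ge0.
  set Z := w / (a + w) + w * (1 - a / nR) * (w / (a + w)) ^+ 2 in W.
  have Z0 : 0 <= Z.
    by apply: addr_ge0 => //; do 2?apply: mulr_ge0 => //; exact: exprn_ge0.
  have fl : Z <= 100 * F.
    apply: (@le_trans _ _ (100 * (w / nR + (1 + w ^+ 2 / nR) * (1 - r1) + w * (1 - r1) ^+ 2))).
      apply: factor_lower => //; apply: (le_trans _ dge).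
      exact: defect_bound_lower.
    by apply: ler_wpM2l.
  apply: (@le_trans _ _ (c * (qp R m t * PR) * Z)).
    have -> : c * (qp R m t * PR) * Z = qp R m t * (c * PR * Z) by ring.
    exact: ler_wpM2l.
  have -> : 100 * c * (x0 * F) = c * x0 * (100 * F) by ring.
  have qPR0 : 0 <= qp R m t * PR.
    by rewrite -qE; apply: mulr_ge0; [exact: kap_ge0 | exact: qp_ge0].
  apply: ler_pM => //; first exact: mulr_ge0.
  exact: ler_wpM2l.
(* Now m < 0: only the reflected term is left. As a <= 0, d >= 1/5, so the factor [F] is at least
   1/5 and the majorant dominates. *)
rewrite subr0 ger0_norm; last first.
  by apply: mulr_ge0; [exact: kap_ge0 | exact: qp_ge0].
apply: (le_trans BL).
have a0 : a <= 0 by rewrite /a subr_le0 ler_nat ltnW.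
have G0 : 0 < nR + w + 1 by rewrite ltr_wpDl // addr_ge0.
have aK1 : 0 < a + (K%:R + 1) by rewrite addrA ltr_wpDl.
have dd : 1 / 5 <= 1 - r1.
  apply: (le_trans _ dge).
  rewrite ler_pdivlMr ?mulr_gt0 //.
  apply: (@le_trans _ _ (1 / 5 * (12 / 10 * nR * (2 * w + 5)))).
    apply: ler_wpM2l => //; apply: ler_pM; rewrite ?(ltW G0) ?(ltW aK1) //.
      by move: w1 wn; clear_bool; lra.
    by move: a0 kle; clear_bool; lra.
  have : nR * (w + 3) <= (nR - a) * (K%:R - w).
    apply: ler_pM => //; first exact: addr_ge0.
      by move: a0; clear_bool; lra.
    by move: kge; clear_bool; lra.
  have : 0 <= nR * w by exact: mulr_ge0.
  by move: n0; clear_bool; lra.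
have F5 : 1 / 5 <= F.
  apply: (le_trans _ fge).
  have h1 : 0 <= w / nR by exact: divr_ge0.
  have h2 : 0 <= w ^+ 2 / nR * (1 - r1).
    by apply: mulr_ge0 => //; apply: divr_ge0 => //; exact: exprn_ge0.
  have h3 : 0 <= w * (1 - r1) ^+ 2 by apply: mulr_ge0 => //; exact: exprn_ge0.
  by move: dd h1 h2 h3; clear_bool; lra.
have xF : x0 * (1 / 5) <= x0 * F by exact: ler_wpM2l.
have xF0 : 0 <= x0 * F by apply: mulr_ge0 => //; exact: le_trans F5.
have : 1 * (x0 * F) <= c * (x0 * F) by exact: ler_wpM2r.
by move: xF xF0; clear_bool; lra.
Qed.

(** * The discrete recursion *)

(* [m! / h ^ m * Dk h c k m] counts the ways to put m labelled points into k
   cells so that, for all i <= k, at least i * h - c points lie in the first i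
   cells. *)
Fixpoint Dk (R : realType) (h c : R) (k m : nat) : R :=
  match k with
  | 0%N => (m == 0%N)%:R
  | k'.+1 => if k'.+1%:R * h <= m%:R + c
             then \sum_(j < m.+1) qp R j h * Dk R h c k' (m - j) else 0
  end.

Lemma qp_sum_shift (R : realType) (h : R) (s p : nat) (g : nat -> R) :
  \sum_(j < p.+1) qp R j h * (if (s <= p - j)%N then g (p - j - s)%N else 0) =
  if (s <= p)%N then \sum_(j < (p - s).+1) qp R j h * g (p - s - j)%N else 0.
Proof.
case: (leqP s p) => sp; last first.
  rewrite big1 // => j _; case: leqP; rewrite ?mulr0 // => /leq_trans.
  by move=> /(_ _ (leq_subr _ _)); rewrite leqNgt sp.
rewrite (big_ord_widen_cond p.+1 xpredT (fun j => qp R j h * g (p - s - j)%N));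
  last by rewrite ltnS leq_subr.
rewrite [RHS]big_mkcond /=; apply: eq_bigr => j _; rewrite ltnS.
have jp : (j <= p)%N by rewrite -ltnS ltn_ord.
rewrite [in RHS]leq_subRL // addnC -leq_subRL //; case: ifP => _; last by rewrite mulr0.
by rewrite subnAC.
Qed.

(** Without the killing condition the recursion is that of [qp_add], solved by q_m(k h). *)
Lemma Dk_bounds (R : realType) (h c : R) (k m : nat) : 0 <= h ->
  0 <= Dk R h c k m <= qp R m (k%:R * h).
Proof.
move=> h0; elim: k m => [|k IH] m.
  rewrite /= mul0r /qp; case: m => [|m] /=; first by rewrite expr0 fact0 divr1 lexx ler01.
  by rewrite expr0n /= mul0r lexx.
have q0 : 0 <= qp R m (k.+1%:R * h) by apply: qp_ge0; rewrite mulr_ge0.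
rewrite /=; case: ifP => _; last by rewrite lexx.
apply/andP; split.
  by apply: sumr_ge0 => j _; rewrite mulr_ge0 ?qp_ge0 //; have /andP[] := IH (m - j)%N.
rewrite -natr1 mulrDl mul1r qp_add; apply: ler_sum => j _.
by apply: ler_wpM2l; [exact: qp_ge0 | have /andP[] := IH (m - j)%N].
Qed.

Lemma qp_le_pow (R : realType) (p P : nat) (t v : R) : 0 <= t -> t <= v -> (p <= P)%N ->
  qp R p t <= (1 + v) ^+ P.
Proof.
move=> t0 tv pP; apply: (@le_trans _ _ (t ^+ p)).
  rewrite /qp ler_pdivrMr ?ltr0n ?fact_gt0 //.
  by rewrite ler_peMr ?exprn_ge0 // ler1n fact_gt0.
apply: (@le_trans _ _ ((1 + v) ^+ p)).
  by apply: lerXn2r; rewrite ?nnegrE; lra.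
by apply: ler_weXn2l => //; lra.
Qed.

Lemma major_add (R : realType) (n w : R) (K p : nat) (t h : R) :
  major R n w K p (t + h) = \sum_(j < p.+1) qp R j h * major R n w K (p - j) t.
Proof.
rewrite /major !qs_add !mulr_sumr -sumrB -big_split /=; apply: eq_bigr => j _.
by ring.
Qed.

Lemma qs_norm (R : realType) (s p P : nat) (t v : R) : 0 <= t -> t <= v -> (p <= P)%N ->
  `|qs R s p t| <= (1 + v) ^+ P.
Proof.
move=> t0 tv pP; rewrite /qs; case: ifP => _; last by rewrite normr0; pos.
rewrite ger0_norm ?qp_ge0 //; apply: qp_le_pow => //.
exact: leq_trans (leq_subr _ _) pP.
Qed.

Lemma norm_comb3_le (R : realType) (a b c x y z q : R) :
  `|x| <= q -> `|y| <= q -> `|z| <= q ->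
  `|a * x - b * y + c * z| <= (`|a| + `|b| + `|c|) * q.
Proof.
move=> xq yq zq; apply: (le_trans (ler_normD _ _)).
rewrite !mulrDl normrM; apply: lerD; last exact: ler_wpM2l.
apply: (le_trans (ler_normB _ _)); rewrite !normrM.
by apply: lerD; apply: ler_wpM2l.
Qed.

Lemma major_norm (R : realType) (n w : R) (K : nat) (P : nat) (v : R) : exists B : R,
  forall p t, 0 <= t -> t <= v -> (p <= P)%N -> `|major R n w K p t| <= B.
Proof.
exists ((`|(w / n + (2 + w ^+ 2 / n) + w) * kap R n w K| +
         `|((2 + w ^+ 2 / n) + 2 * w) * kap R n w K.+1| +
         `|w * kap R n w K.+2|) * (1 + v) ^+ P).
by move=> p t t0 tv pP; apply: norm_comb3_le; exact: qs_norm.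
Qed.

(** The slack [th] covers both barriers, w and w - h, between which [Qn] is squeezed later. [B] may
    depend on n, u, w and K but not on the mesh, so its term vanishes as h tends to 0. *)
Lemma discrete_bound (R : realType) : exists c : R, 0 <= c /\
  forall (n : nat) (u w : R) (K : nat),
  1 <= u -> u <= n%:R / 10 -> 1 <= w -> w <= n%:R / 10 ->
  2 * w + 3 <= K%:R -> K%:R <= 2 * w + 4 ->
  let v := n%:R + w - u in let r := v / (n%:R + w + 1) in
  exists B : R, forall (N : nat) (h th : R), v = N%:R * h -> 0 < h -> h <= 1 / 2 ->
    0 <= th -> th <= h ->
    `|Dk R h (w - th) N n / qp R n v - 1 + r ^+ K.+2| <=
    c * (r ^+ K * (w / n%:R + (2 + w ^+ 2 / n%:R) * (1 - r) + w * (1 - r) ^+ 2)) + B * h.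
Proof.
have [c cE] : exists c : R, c = 100 * (1000 * expR 64) by exists (100 * (1000 * expR 64)).
have c0 : 0 <= c by rewrite cE; have := expR_ge0 (64 : R); lra.
exists c; split=> // n u w K u1 un w1 wn Kge Kle v r.
have bnd p t := boundary R n K w p t w1 wn Kge Kle.
rewrite -cE in bnd; clear cE.
have n0 : 0 < n%:R :> R by lra.
have v0 : 0 < v by rewrite /v; lra.
have G0 : 0 < n%:R + w + 1 by lra.
pose L := K.+2.
have LE : L%:R = K%:R + 2 :> R by rewrite /L -addn2 natrD.
pose P := (n + L)%N.
have [B1 B1P] := major_norm R n%:R w K P v.
pose Bd := (2 + kap R n%:R w L) * (1 + v) ^+ P + c * B1.
have kL0 : 0 <= kap R n%:R w L by apply: kap_ge0; lra.
have Q0 : 0 < qp R n v by rewrite /qp divr_gt0 ?exprn_gt0 // ltr0n fact_gt0.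
have pw0 : 0 <= (1 + v) ^+ P by pos.
have B10 : 0 <= B1.
  by apply: (le_trans _ (B1P 0%N 0 _ _ _)) => //; exact: ltW.
(* [Bd] bounds both |f| and |M| on the whole grid, and e^v bounds (1 + h)^N because N h = v. *)
exists (2 * Bd * P%:R * (expR v) / qp R n v).
move=> N h th vE h0 h12 th0 thh.
have kv k : (k <= N)%N -> 0 <= k%:R * h /\ k%:R * h <= v.
  move=> kN; split; first by rewrite mulr_ge0 // ltW.
  by rewrite vE ler_pM2r // ler_nat.
pose Ds k p : R := if (L <= p)%N then Dk R h (w - th) k (p - L)%N else 0.
(* At p = m + L this is [Dk] minus the reflected solution q_m - kap L * q_(m + L); for m < 0 both
   [Dk] and q_m are read as 0. *)
pose f k p : R := Ds k p + (kap R n%:R w L * qs R 0 p (k%:R * h) - qs R L p (k%:R * h)).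
pose M k p : R := c * major R n%:R w K p (k%:R * h).
(* One unit wider than the barrier, since passing from p to p - 1 moves the barrier by 1. A bad
   point of [rel] has t between m + w - th and m + w + 1, and th <= 1/2 accounts for the 1/2 in
   [boundary]. *)
pose rel k p := k%:R * h <= p%:R - L%:R + w + 1.
pose good k p := k%:R * h <= p%:R - L%:R + (w - th).
have kS k : k.+1%:R * h = k%:R * h + h by rewrite -natr1; ring.
have cmp : `|f N P| <= M N P + 2 * Bd * P%:R * h * ((1 + h) ^+ N - 1).
  apply: (@comparison R P h Bd f M rel good N) => //.
  - by lra.
  - by rewrite /Bd addr_ge0 ?mulr_ge0 // addr_ge0.
  (* At time 0, [rel] forces p > 2, so the majorant vanishes; the initial value of [Dk] cancels q_(p
     - L)(0), which is 1 exactly for p = L. *)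
  - move=> p pP; rewrite /rel mul0r => re.
    have p3 : (2 < p)%N by rewrite -(@ltr_nat R); lra.
    have qs0 s : (s < p)%N -> qs R s p 0 = 0.
      by move=> sp; rewrite /qs (ltnW sp) /qp expr0n subn_eq0 leqNgt sp mul0r.
    have z2 : qs R 2 p 0 = 0 by apply: qs0.
    have z1 : qs R 1 p 0 = 0 by apply: qs0; exact: ltn_trans p3.
    have z0 : qs R 0 p 0 = 0 by apply: qs0; exact: ltn_trans p3.
    have -> : M 0%N p = 0.
      by rewrite /M /major mul0r z0 z1 z2; ring.
    rewrite /f mul0r z0 mulr0 sub0r /Ds /qs.
    case: ifP => Lp; last by rewrite subr0 normr0.
    rewrite /= /qp expr0n subn_eq0.
    by case: leqP => h1; rewrite ?fact0 ?mul0r ?subrr ?normr0 //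
       (_ : p - L = 0)%N ?fact0 ?divr1 ?subrr ?normr0 //; apply/eqP.
  - move=> k p kN pP re ng.
    have [k0 k1] := kv _ kN.
    rewrite /f /M; have -> : Ds k.+1 p = 0.
      rewrite /Ds; case: ifP => // Lp /=.
      by case: ifP => // gd; move: ng; rewrite /good -natrB // gd.
    rewrite add0r; apply: bnd => // _.
    by move: ng; rewrite /good -ltNge; lra.
  - move=> k p kN pP gd; split.
    + by move: gd; rewrite /good /rel kS; lra.
    + move=> p0; move: gd; rewrite /good /rel kS -subn1 natrB //; lra.
    rewrite /f; under eq_bigr do rewrite mulrDr.
    rewrite big_split /=; congr (_ + _).
      rewrite /Ds qp_sum_shift; case: ifP => // Lp /=.
      by move: gd; rewrite /good -natrB // => ->.
    rewrite kS !qs_add mulr_sumr -sumrB; apply: eq_bigr => j _; ring.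
  - move=> k p; rewrite /M kS major_add mulr_sumr; apply: eq_bigr => j _; ring.
  - move=> k p kN pP; have [k0 k1] := kv _ kN.
    rewrite /f /Bd.
    have b1 : `|Ds k p| <= (1 + v) ^+ P.
      rewrite /Ds; case: ifP => Lp; last by rewrite normr0.
      have /andP[D0 D1] := Dk_bounds R h (w - th) k (p - L) (ltW h0).
      rewrite ger0_norm //; apply: (le_trans D1); apply: qp_le_pow => //.
      exact: leq_trans (leq_subr _ _) pP.
    have b2 := qs_norm R 0 p P _ v k0 k1 pP.
    have b3 := qs_norm R L p P _ v k0 k1 pP.
    have b4 : `|kap R n%:R w L * qs R 0 p (k%:R * h)| <= kap R n%:R w L * (1 + v) ^+ P.
      by rewrite normrM ger0_norm //; apply: ler_wpM2l.
    have := ler_normD (Ds k p) (kap R n%:R w L * qs R 0 p (k%:R * h) - qs R L p (k%:R * h)).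
    have := ler_normB (kap R n%:R w L * qs R 0 p (k%:R * h)) (qs R L p (k%:R * h)).
    have : 0 <= c * B1 by exact: mulr_ge0.
    by lra.
  - move=> k p kN pP; have [k0 k1] := kv _ kN.
    rewrite /M normrM ger0_norm // /Bd.
    have : c * `|major R n%:R w K p (k%:R * h)| <= c * B1 by apply: ler_wpM2l => //; apply: B1P.
    have : 0 <= (2 + kap R n%:R w L) * (1 + v) ^+ P by rewrite mulr_ge0 // addr_ge0.
    by lra.
  - by rewrite /rel -vE /P natrD /v; lra.
(* At the end point m = n, t = v the ratio does not depend on i, so the shifted terms form a
   geometric sequence. *)
have rhor i : (i : R) >= 0 -> rho R n%:R n%:R w v i = r.
  by move=> i0; rewrite /rho /r; field; lra.
have kq l : kap R n%:R w l * qp R (n + l) v = qp R n v * r ^+ l.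
  rewrite kap_qp_prod; [|lra|lra].
  under eq_bigr do rewrite rhor //.
  by rewrite prodr_const card_ord.
have fE : f N P = qp R n v * (Dk R h (w - th) N n / qp R n v - 1 + r ^+ K.+2).
  rewrite /f -vE /Ds /P leq_addl addnK /qs leq_addl addnK subn0 leq0n kq.
  by rewrite /L; field; lra.
have ME : M N P = qp R n v *
    (c * (r ^+ K * (w / n%:R + (2 + w ^+ 2 / n%:R) * (1 - r) + w * (1 - r) ^+ 2))).
  rewrite /M -vE /P /L addnS addnS majorE; [|lra|lra].
  rewrite natrD addrK kq !rhor ?addr_ge0 //.
  by ring.
have Bd0 : 0 <= Bd by rewrite /Bd addr_ge0 ?mulr_ge0 // addr_ge0.
have eN : (1 + h) ^+ N - 1 <= expR v.
  have : (1 + h) ^+ N <= expR v.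
    rewrite vE expRM_natl; apply: lerXn2r; rewrite ?nnegrE ?expR_ge0 //; first by lra.
    exact: expR_ge1Dx.
  by lra.
rewrite fE ME normrM gtr0_norm // in cmp.
rewrite -(ler_pM2l Q0); apply: (le_trans cmp).
set X := c * _.
have -> : qp R n v * (X + 2 * Bd * P%:R * expR v / qp R n v * h) =
    qp R n v * X + 2 * Bd * P%:R * h * expR v.
  by field; lra.
rewrite lerD2l.
apply: ler_wpM2l => //.
by rewrite !mulr_ge0 // ltW.
Qed.

(** * Counting *)

Section Counting.
Local Open Scope nat_scope.
Variables (ok : nat -> nat -> bool).

(** Counts the placements of m labelled points into k cells for which each initial block of l cells,
    1 <= l <= k, holds an admissible number of points; j is the number of points in the last
    cell. *)
Fixpoint nplace (k m : nat) : nat :=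
  match k with
  | 0 => m == 0
  | k'.+1 => if ok k'.+1 m then \sum_(j < m.+1) 'C(m, j) * nplace k' (m - j) else 0
  end.

Lemma sum_subset_card (T : finType) (J : {set T}) (g : nat -> nat) :
  \sum_(J' : {set T} | J' \subset J) g #|J'| = \sum_(j < #|J|.+1) 'C(#|J|, j) * g (#|J| - j).
Proof.
rewrite (reindex_inj rev_ord_inj) /=.
rewrite (partition_big (fun J' : {set T} => inord #|J'| : 'I_#|J|.+1) xpredT) //=.
apply: eq_bigr => j _; rewrite subSS.
have jJ : j <= #|J| by rewrite -ltnS ltn_ord.
rewrite bin_sub // subKn // -cards_draws -sum1dep_card big_distrl /=.
rewrite (eq_bigl (fun J' : {set T} => (J' \subset J) && (#|J'| == j))).
  by apply: eq_bigr => J' /andP[_ /eqP ->]; rewrite mul1n.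
move=> J'; case: (boolP (J' \subset J)) => //= sJ.
by rewrite -val_eqE /= inordK // ltnS subset_leq_card.
Qed.

Variables (n N : nat).
Definition below (k : nat) (s : {ffun 'I_n -> 'I_N}) : {set 'I_n} := [set i | s i < k].

(** The predicates [A] on the points outside J make the induction on k possible: they record what
    has already been decided about the later cells. *)
Definition chain (k : nat) (J : {set 'I_n}) (A : 'I_n -> pred nat) (s : {ffun 'I_n -> 'I_N}) :=
  [&& below k s == J, [forall l : 'I_k, ok l.+1 #|below l.+1 s|]
    & [forall i, (i \notin J) ==> A i (s i)]].

(** Fixing the set J' of points in the first k cells puts the points of J outside J' into cell k and
    those outside J strictly beyond it; both facts are moved into the predicate. *)
Lemma chainS (k : nat) (J J' : {set 'I_n}) (A : 'I_n -> pred nat)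
    (s : {ffun 'I_n -> 'I_N}) : J' \subset J ->
  chain k.+1 J A s && (below k s == J') =
  ok k.+1 #|J| && chain k J' (fun i c => if i \in J then c == k else (k < c) && A i c) s.
Proof.
move=> sJ; apply/idP/idP.
- case/andP=> /and3P[/eqP b1 /forallP b2 /forallP b3] /eqP b4.
  have := b2 ord_max; rewrite /= b1 => ->; rewrite /chain b4 eqxx /=.
  apply/andP; split.
    apply/forallP => l; have := b2 (widen_ord (leqnSn k) l); by [].
  apply/forallP => i; apply/implyP => iJ'.
  have : i \notin below k s by rewrite b4.
  rewrite inE -leqNgt => ki.
  case: ifP => iJ.
    have : i \in below k.+1 s by rewrite b1.
    by rewrite inE ltnS eqn_leq ki => ->.
  have : i \notin below k.+1 s by rewrite b1 iJ.
  rewrite inE ltnS -ltnNge => -> /=.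
  by have := b3 i; rewrite iJ.
- case/and4P=> okJ /eqP b1 /forallP b2 /forallP b3.
  have bS : below k.+1 s = J.
    apply/setP => i; rewrite inE ltnS leq_eqVlt.
    have : (s i < k) = (i \in J') by rewrite -b1 inE.
    move=> E; rewrite E; case: (boolP (i \in J')) => iJ'.
      by rewrite orbT (fintype.subsetP sJ).
    rewrite orbF; have := b3 i; rewrite iJ' /=.
    case: ifP => [_ //|_ /andP[ks _]].
    by rewrite gtn_eqF.
  rewrite /chain b1 bS !eqxx /= andbT; apply/andP; split.
    apply/forallP => l; case: (ltnP l k) => lk; first exact: (b2 (Ordinal lk)).
    have -> : nat_of_ord l = k by apply/eqP; rewrite eqn_leq lk -ltnS ltn_ord.
    by rewrite bS.
  apply/forallP => i; apply/implyP => iJ; have := b3 i.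
  have iJ' : i \notin J' by apply: contra iJ; exact: (fintype.subsetP sJ).
  by rewrite iJ' (negPf iJ) /= => /andP[].
Qed.

(** Induction on k, splitting by the set J' of points in the first k cells. The points of J outside
    J' have a single choice, and the sum over J' depends only on its size. *)
Lemma card_chain (k : nat) (J : {set 'I_n}) (A : 'I_n -> pred nat) : k <= N ->
  \sum_(s | chain k J A s) 1 =
  nplace k #|J| * \prod_(i | i \notin J) #|[pred c : 'I_N | (k <= c) && A i c]|.
Proof.
elim: k J A => [|k IH] J A kN.
  rewrite /= cards_eq0; case: eqP => [->|J0]; last first.
    rewrite mul0n big_pred0 // => s; apply/negP => /and3P[/eqP b _ _].
    by apply: J0; rewrite -b; apply/setP => i; rewrite !inE.
  rewrite mul1n sum1_card.
  rewrite (eq_card (B := family (fun i => [pred c : 'I_N | A i c]))).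
    rewrite card_family foldrE big_map big_enum /=.
    by apply: eq_big => i; rewrite ?inE.
  move=> s; apply/idP/familyP => [|b].
    rewrite unfold_in => /and3P[_ _ /forallP b] i.
    by have := b i; rewrite inE.
  rewrite unfold_in; apply/and3P; split.
  - by apply/eqP/setP => i; rewrite !inE.
  - by apply/forallP => -[].
  - by apply/forallP => i; rewrite inE; have := b i; rewrite inE.
rewrite (partition_big (below k) (fun J' => J' \subset J)) /=; last first.
  move=> s /and3P[/eqP <- _ _]; apply/fintype.subsetP => i; rewrite !inE => h.
  exact: ltn_trans h _.
under eq_bigr => J' sJ do rewrite (eq_bigl _ _ (fun s => chainS k J J' A s sJ)).
case: ifP => okJ; last by rewrite mul0n big1 // => J' _; rewrite big_pred0.
rewrite -sum_subset_card big_distrl /=; apply: eq_bigr => J' sJ.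
rewrite /= IH; last exact: ltnW.
congr (_ * _).
rewrite [LHS](bigID (mem J)) /= big1 ?mul1n.
  apply: eq_big => i.
    case: (boolP (i \in J)) => iJ; rewrite ?andbF ?andbT //=.
    by apply: contra iJ; exact: (fintype.subsetP sJ).
  case/andP=> _ iJ; apply: eq_card => c; rewrite !inE (negPf iJ).
  by case: (ltnP k c) => kc; rewrite ?andbF // (ltnW kc).
move=> i /andP[_ iJ]; rewrite (eq_card (B := pred1 (Ordinal kN))) ?card1 // => c.
rewrite !inE iJ -val_eqE /=.
by case: eqP => [->|]; rewrite ?leqnn ?andbF.
Qed.

Lemma card_good :
  #|[set s : {ffun 'I_n -> 'I_N} | [forall l : 'I_N, ok l.+1 #|below l.+1 s|]]| = nplace N n.
Proof.
have := card_chain N [set: 'I_n]%SET (fun _ => predT) (leqnn N).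
rewrite cardsT card_ord [X in _ * X]big_pred0 ?muln1; last by move=> i; rewrite inE.
move=> <-; rewrite -sum1_card; apply: eq_bigl => s; rewrite inE /chain.
have -> : below N s == [set: 'I_n]%SET by apply/eqP/setP => i; rewrite !inE ltn_ord.
have -> : [forall i : 'I_n, (i \notin [set: 'I_n]%SET) ==> xpredT (nat_of_ord (s i))]
  by apply/forallP => i; rewrite implybT.
by rewrite andbT.
Qed.

End Counting.

Lemma nplace_Dk (R : realType) (h c : R) (k m : nat) :
  (nplace (fun k m => k%:R * h <= m%:R + c) k m)%:R * qp R m h = Dk R h c k m.
Proof.
elim: k m => [|k IH] m.
  rewrite /= /qp; case: m => [|m] /=; first by rewrite expr0 fact0 divr1 mul1r.
  by rewrite mul0r.
rewrite [nplace _ _ _]/=.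
have -> : Dk R h c k.+1 m = if k.+1%:R * h <= m%:R + c
             then \sum_(j < m.+1) qp R j h * Dk R h c k (m - j) else 0 by [].
case: ifP => _; last by rewrite mul0r.
rewrite natr_sum mulr_suml; apply: eq_bigr => j _; rewrite -IH natrM.
have jm : (j <= m)%N by rewrite -ltnS ltn_ord.
have fu (i : nat) : i`!%:R != 0 :> R by rewrite pnatr_eq0 -lt0n fact_gt0.
have -> : qp R m h = h ^+ j * h ^+ (m - j) / ('C(m, j)%:R * (j`!%:R * (m - j)`!%:R)).
  by rewrite /qp -exprD subnKC // -!natrM bin_fact.
rewrite /qp.
have bu : ('C(m, j)%:R : R) != 0 by rewrite pnatr_eq0 -lt0n bin_gt0.
by field; rewrite !fu bu.
Qed.

(** * The reflected term *)

(** The inequality t <= sinh t. A version with error t^2 / 2^j is proved by halving: with x =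
    e^(t/2) and y = 1/x, e^t - e^(-t) = (x - y)(x + y) and x + y >= 2. Letting j grow removes the
    error. *)
Lemma expR_sub_expRN_ge (R : realType) (t : R) : 0 <= t -> 2 * t <= expR t - expR (- t).
Proof.
have H (j : nat) : forall t : R, 0 <= t -> 2 * t - t ^+ 2 / 2 ^+ j <= expR t - expR (- t).
  elim: j => [|j IH] {}t t0.
    rewrite expr0 divr1 expRN.
    have e1 := expR_ge1Dx t.
    have p1 : 0 < 1 + t by lra.
    have : (expR t)^-1 <= (1 + t)^-1 by rewrite lef_pV2 ?posrE ?expR_gt0.
    have : (1 + t)^-1 = 1 - t + t ^+ 2 - t ^+ 3 / (1 + t) by field; lra.
    have : 0 <= t ^+ 3 / (1 + t) by pos.
    by lra.
  have s0 : 0 <= t / 2 by lra.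
  have := IH _ s0; set s := t / 2 in s0 * => h.
  have h2 : expR (- s) <= expR s by rewrite ler_expR; lra.
  have xy : expR s * expR (- s) = 1 by rewrite -expRD subrr expR0.
  have -> : 2 * t - t ^+ 2 / 2 ^+ j.+1 = 2 * (2 * s - s ^+ 2 / 2 ^+ j).
    rewrite /s (exprS 2 j); have : 2 ^+ j != 0 :> R by rewrite expf_neq0.
    by move: (2 ^+ j) => q q0; field.
  have -> : expR t = expR s * expR s by rewrite -expRD; congr expR; rewrite /s; field.
  have -> : expR (- t) = expR (- s) * expR (- s).
    by rewrite -expRD; congr expR; rewrite /s; field.
  have x0 := expR_gt0 s; have y0 := expR_gt0 (- s).
  move: h h2 xy x0 y0; move: (expR s) (expR (- s)) => x y h h2 xy x0 y0.
  have xy2 : 2 <= x + y by nra.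
  have : 0 <= (x - y) * (x + y - 2) by apply: mulr_ge0; lra.
  by lra.
move=> t0; rewrite leNgt; apply/negP => lt.
pose g := 2 * t - (expR t - expR (- t)).
have g0 : 0 < g by rewrite /g; lra.
have q0 : 0 <= t ^+ 2 / g by pos.
have := H (Num.Def.archi_bound (t ^+ 2 / g)) t t0.
have bd := archi_boundP q0; set m := Num.Def.archi_bound _ in bd *.
have m2 : (m%:R : R) <= 2 ^+ m by rewrite -natrX ler_nat ltnW // ltn_expl.
have p2 : 0 < 2 ^+ m :> R by rewrite exprn_gt0.
suff : t ^+ 2 / 2 ^+ m < g by rewrite /g; lra.
rewrite ltr_pdivrMr // mulrC -ltr_pdivrMr //.
exact: lt_le_trans m2.
Qed.

Lemma expR_dist_le (R : realType) (X Y m D : R) : m <= X -> m <= Y ->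
  X - Y <= D -> Y - X <= D -> `|expR (- X) - expR (- Y)| <= D * expR (- m).
Proof.
have H (a b : R) : m <= a -> b - a <= D -> 0 <= D -> expR (- a) - expR (- b) <= D * expR (- m).
  move=> ma ba D0.
  have -> : expR (- a) - expR (- b) = expR (- a) * (1 - expR (a - b)).
    by rewrite mulrBr mulr1 -expRD; congr (_ - expR _); ring.
  have e1 := expR_ge1Dx (a - b).
  apply: (@le_trans _ _ (expR (- a) * D)).
    by apply: ler_wpM2l; [exact: expR_ge0 | lra].
  by rewrite mulrC; apply: ler_wpM2l => //; rewrite ler_expR; lra.
move=> mX mY XY YX; have D0 : 0 <= D by lra.
rewrite ler_norml; apply/andP; split; last exact: H.
by rewrite lerNl opprB; apply: H.
Qed.

Lemma mul_expRN_half_le (R : realType) (y : R) : y * expR (- (y / 2)) <= 2.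
Proof.
have h : y / 2 <= expR (y / 2) by have := expR_ge1Dx (y / 2); lra.
have e0 := expR_ge0 (- (y / 2)).
have ee : expR (y / 2) * expR (- (y / 2)) = 1 by rewrite -expRD subrr expR0.
by have := ler_wpM2r e0 h; rewrite ee; lra.
Qed.

Lemma ln_ge (R : realType) (x : R) : 0 < x -> 1 - x^-1 <= ln x.
Proof.
move=> x0; have xV0 : 0 < x^-1 by rewrite invr_gt0.
have : ln (1 + (x^-1 - 1)) <= x^-1 - 1 by apply: le_ln1Dx; lra.
by rewrite addrC subrK lnV ?posrE //; lra.
Qed.

Lemma ln_le (R : realType) (x : R) : 0 < x -> ln x <= x - 1.
Proof.
move=> x0; have : ln (1 + (x - 1)) <= x - 1 by apply: le_ln1Dx; lra.
by rewrite addrC subrK.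
Qed.

(** Put B = n + w, A = n - w + b. The hypothesis says B/A = e^(2t) with t = (B - A)/(2n), so B - A =
    sqrt(AB) (e^t - e^(-t)) >= 2t sqrt(AB), that is sqrt(AB) <= n. Expanding AB <= n^2 gives b (n +
    w) <= w^2. *)
Lemma reflection_defect_le (R : realType) (n : nat) (w b : R) :
  (0 < n)%N -> 0 < w -> w <= n%:R / 10 -> 0 <= b -> b <= w ->
  (n%:R + w) ^+ n / (expR (n%:R + w) * n`!%:R) =
  (n%:R - w + b) ^+ n / (expR (n%:R - w + b) * n`!%:R) ->
  b * n%:R <= w ^+ 2.
Proof.
move=> n0 w0 wn b0 bw E.
have nR0 : 0 < n%:R :> R by rewrite ltr0n.
set B := n%:R + w in E; set A := n%:R - w + b in E.
have A0 : 0 < A by rewrite /A; lra.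
have f0 : n`!%:R != 0 :> R by rewrite pnatr_eq0 -lt0n fact_gt0.
pose t := (B - A) / (2 * n%:R).
have t0 : 0 <= t by rewrite /t /A /B; pos.
have BA : B = A * (expR t * expR t).
  apply/eqP; rewrite -(@eqrXn2 _ n) //; first last.
  - by apply: ltW; rewrite !mulr_gt0 // expR_gt0.
  - by rewrite /B; lra.
  rewrite exprMn -expRD -expRM_natl.
  have -> : n%:R * (t + t) = B - A by rewrite /t; field; lra.
  rewrite expRB.
  have eB := expR_gt0 B; have eA := expR_gt0 A.
  apply/eqP; move: E; move: (B ^+ n) (A ^+ n) (expR B) (expR A) eB eA => p q x y x0 y0 E.
  have -> : p = p / (x * n`!%:R) * (x * n`!%:R) by field; rewrite f0; lra.
  by rewrite E; field; rewrite f0; lra.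
have sh := expR_sub_expRN_ge _ _ t0.
have ee : expR t * expR (- t) = 1 by rewrite -expRD subrr expR0.
have e0 := expR_gt0 t.
move: sh BA ee e0; move: (expR t) (expR (- t)) => s s' sh BA ee e0.
have h1 : 2 * t * (A * s) <= B - A.
  have -> : B - A = (s - s') * (A * s).
    by rewrite BA -[X in _ - X = _]mulr1 -ee; ring.
  by apply: ler_wpM2r => //; pos.
have BA0 : 0 < B - A by rewrite /A /B; lra.
have As : A * s <= n%:R.
  have tE : 2 * t = (B - A) / n%:R by rewrite /t; field; lra.
  rewrite tE mulrAC ler_pdivrMr // in h1.
  by move: h1; rewrite ler_pM2l.
have AB : A * B <= n%:R * n%:R.
  have -> : A * B = (A * s) * (A * s) by rewrite BA; ring.
  by apply: ler_pM => //; pos.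
have : 0 <= b * w by pos.
by move: AB; rewrite /A /B; lra.
Qed.

Lemma negln_ratio_bounds (R : realType) (x y : R) : 0 < x -> x <= y ->
  (y - x) / y <= - ln (x / y) /\ - ln (x / y) <= (y - x) / x.
Proof.
move=> x0 xy; have y0 : 0 < y by exact: lt_le_trans xy.
have q0 : 0 < x / y by exact: divr_gt0.
split.
  have -> : (y - x) / y = 1 - x / y by field; rewrite gt_eqF.
  by have := ln_le _ _ q0; lra.
have -> : (y - x) / x = (x / y)^-1 - 1 by field; rewrite !gt_eqF.
by have := ln_ge _ _ q0; lra.
Qed.

(** * Elementary estimates for the remainder and for the two powers *)

Section Remainder.
Variables (R : realType) (n u w : R).

Let v := n + w - u.
Let y := u * w / v.
Let S := (u + w) / n + u * w ^+ 2 / n ^+ 2.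
Let z := u * w / n.

Lemma remainderE : n != 0 -> S = u / n + w / n + u / n * (w ^+ 2 / n).
Proof. by move=> n0; rewrite /S; field. Qed.

(** The reflected term decays almost like e^(-2y); settling for 3/2 leaves a surplus e^(-y/2) over
    the decay in the statement. *)
Lemma exponent_le : 1 <= u -> u <= n / 10 -> 1 <= w -> w <= n / 10 ->
  3 / 2 * y <= 2 * w * (u / (n + w + 1)).
Proof.
move=> u1 un w1 wn.
have v0 : 0 < v by rewrite /v; lra.
have G0 : 0 < n + w + 1 by lra.
have -> : 3 / 2 * y = 3 / 2 * u * w / v by rewrite /y; field; rewrite gt_eqF.
have -> : 2 * w * (u / (n + w + 1)) = 2 * u * w / (n + w + 1) by field; rewrite gt_eqF.
rewrite ler_pdivrMr // [_ / _ * v]mulrAC ler_pdivlMr //.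
have : 0 <= u * w * (2 * v - 3 / 2 * (n + w + 1)).
  by apply: mulr_ge0; [apply: mulr_ge0; lra | rewrite /v; lra].
by lra.
Qed.

Lemma uw_div_le : 1 <= u -> u <= n / 10 -> 1 <= w -> w <= n / 10 ->
  0 <= z /\ z <= 11 / 10 * y.
Proof.
move=> u1 un w1 wn.
have v0 : 0 < v by rewrite /v; lra.
have n0 : 0 < n by lra.
have uw0 : 0 <= u * w by apply: mulr_ge0; lra.
split; first by apply: divr_ge0 => //; exact: ltW.
rewrite /y /z ler_pdivrMr // mulrA mulrAC ler_pdivlMr //.
have : u * w * v <= u * w * (11 / 10 * n) by apply: ler_wpM2l => //; rewrite /v; lra.
by move: v0; clear_bool; lra.
Qed.

Lemma exponent_gain : 0 <= z -> z <= 11 / 10 * y ->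
  z * expR (- (3 / 2 * y)) <= 11 / 5 * expR (- y).
Proof.
move=> z0 zy.
have -> : expR (- (3 / 2 * y)) = expR (- (y / 2)) * expR (- y).
  by rewrite -expRD; congr expR; field.
rewrite mulrA; apply: ler_wpM2r; first exact: expR_ge0.
have := mul_expRN_half_le _ y; have := ler_wpM2r (expR_ge0 (- (y / 2))) zy.
by clear_bool; lra.
Qed.

(* The surplus e^(-y/2) absorbs the terms carrying an extra factor uw/n. *)
Lemma absorb (c1 c2 : R) : 1 <= u -> u <= n / 10 -> 1 <= w -> w <= n / 10 ->
  0 <= c1 -> 0 <= c2 ->
  (c1 * S + c2 * (u / n * z)) * expR (- (3 / 2 * y)) <= (c1 + 11 / 5 * c2) * S * expR (- y).
Proof.
move=> u1 un w1 wn c10 c20.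
have n0 : 0 < n by lra.
have v0 : 0 < v by rewrite /v; lra.
have [u0 w0] : 0 <= u /\ 0 <= w by split; lra.
have nV0 : 0 <= n^-1 by rewrite invr_ge0 ltW.
have y0 : 0 <= y by apply: divr_ge0; [exact: mulr_ge0 | exact: ltW].
have [z0 zy] := uw_div_le u1 un w1 wn.
have g := exponent_gain z0 zy.
have a0 : 0 <= u / n by exact: mulr_ge0.
have uS : u / n <= S.
  rewrite remainderE ?gt_eqF //.
  have : 0 <= w / n by exact: mulr_ge0.
  have : 0 <= u / n * (w ^+ 2 / n) by do 2!apply: mulr_ge0 => //; exact: exprn_ge0.
  by clear_bool; lra.
have S0 : 0 <= S by exact: le_trans uS.
have e0 := expR_ge0 (- y).
have e32 : expR (- (3 / 2 * y)) <= expR (- y) by rewrite ler_expR; move: y0; clear_bool; lra.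
have p1 := ler_wpM2l (mulr_ge0 c10 S0) e32.
have p2 := ler_wpM2l (mulr_ge0 c20 a0) g.
have p3 := ler_wpM2l c20 (ler_wpM2r e0 uS).
by move: p1 p2 p3; clear_bool; lra.
Qed.

Lemma pow_decay (l : nat) : 1 <= u -> u <= n / 10 -> 1 <= w -> w <= n / 10 ->
  2 * w <= l%:R -> (v / (n + w + 1)) ^+ l <= expR (- (3 / 2 * y)).
Proof.
move=> u1 un w1 wn lw.
have v0 : 0 < v by rewrite /v; lra.
have G0 : 0 < n + w + 1 by lra.
have [u0 w0] : 0 <= u /\ 0 <= w by split; lra.
have rle : v / (n + w + 1) <= expR (- ((u + 1) / (n + w + 1))).
  have -> : v / (n + w + 1) = 1 + - ((u + 1) / (n + w + 1)).
    by rewrite /v; field; rewrite gt_eqF.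
  exact: expR_ge1Dx.
apply: (@le_trans _ _ (expR (- ((u + 1) / (n + w + 1))) ^+ l)).
  by apply: lerXn2r; rewrite ?nnegrE ?expR_ge0 // divr_ge0 // ltW.
rewrite -expRM_natl ler_expR mulrN lerN2.
apply: le_trans (exponent_le u1 un w1 wn) _.
apply: ler_pM => //; [exact: mulr_ge0 | exact: divr_ge0 u0 (ltW G0) |].
by rewrite ler_pM2r ?invr_gt0 // lerDl.
Qed.

(** As 1 - r <= 2u/n, the bracket is at most 4 S + 4 (u/n) z, and [absorb] yields 4 + 44/5 = 64/5 <=
    13. *)
Lemma remainder_le (K : nat) : 1 <= u -> u <= n / 10 -> 1 <= w -> w <= n / 10 ->
  2 * w <= K%:R -> forall r : R, r = v / (n + w + 1) ->
  r ^+ K * (w / n + (2 + w ^+ 2 / n) * (1 - r) + w * (1 - r) ^+ 2) <= 13 * S * expR (- y).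
Proof.
move=> u1 un w1 wn Kw r rdef.
have n0 : 0 < n by lra.
have v0 : 0 < v by rewrite /v; lra.
have G0 : 0 < n + w + 1 by lra.
have [u0 w0] : 0 <= u /\ 0 <= w by split; lra.
have nV0 : 0 <= n^-1 by rewrite invr_ge0 ltW.
have r0 : 0 <= r by rewrite rdef divr_ge0 // ltW.
have rE : 1 - r = (u + 1) / (n + w + 1) by rewrite rdef /v; field; rewrite gt_eqF.
have q0 : 0 <= 1 - r by rewrite rE; apply: divr_ge0; [lra | exact: ltW].
have q1 : 1 - r <= 2 * (u / n).
  rewrite rE mulrA; apply: ler_pM; rewrite ?invr_ge0; [lra | exact: ltW | lra |].
  by rewrite lef_pV2 ?posrE //; lra.
have a0 : 0 <= u / n by exact: mulr_ge0.
have w2n0 : 0 <= w ^+ 2 / n by apply: mulr_ge0 => //; exact: exprn_ge0.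
have wn0 : 0 <= w / n by exact: mulr_ge0.
have b1 : w / n + (2 + w ^+ 2 / n) * (1 - r) + w * (1 - r) ^+ 2 <= 4 * S + 4 * (u / n * z).
  have h1 : (2 + w ^+ 2 / n) * (1 - r) <= (2 + w ^+ 2 / n) * (2 * (u / n)).
    by apply: ler_wpM2l => //; exact: addr_ge0.
  have h2 : (1 - r) ^+ 2 <= (2 * (u / n)) ^+ 2.
    by apply: lerXn2r => //; rewrite nnegrE; exact: mulr_ge0.
  have := ler_wpM2l w0 h2.
  have -> : w * (2 * (u / n)) ^+ 2 = 4 * (u / n * z).
    by rewrite /z; field; rewrite gt_eqF.
  have : 0 <= u / n * (w ^+ 2 / n) by exact: mulr_ge0.
  rewrite remainderE ?gt_eqF //.
  by move: h1 wn0 a0; clear_bool; lra.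
have rK : r ^+ K <= expR (- (3 / 2 * y)) by rewrite rdef; exact: pow_decay.
have := absorb 4 4 u1 un w1 wn (ler0n _ 4) (ler0n _ 4).
have -> : (4 + 11 / 5 * 4) * S * expR (- y) = 64 / 5 * (S * expR (- y)) by field.
have SE0 : 0 <= S * expR (- y).
  apply: mulr_ge0; last exact: expR_ge0.
  by rewrite remainderE ?gt_eqF // !addr_ge0 //; exact: mulr_ge0.
move=> ab.
apply: (@le_trans _ _ ((4 * S + 4 * (u / n * z)) * expR (- (3 / 2 * y)))).
  rewrite mulrC; apply: ler_pM => //; last exact: exprn_ge0.
  apply: addr_ge0; last by apply: mulr_ge0 => //; exact: exprn_ge0.
  by apply: addr_ge0 => //; apply: mulr_ge0 => //; exact: addr_ge0.
by apply: (le_trans ab); move: SE0; clear_bool; lra.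
Qed.

(** Bounds the exponent of r^L minus that of the power in the statement. The difference l - (2w - b)
    is at most 6 + w^2/n, which produces the terms u/n and u w^2/n^2 of S. *)
Lemma log_diff_le1 (b l : R) : 1 <= u -> u <= n / 10 -> 1 <= w -> w <= n / 10 ->
  b <= w ^+ 2 / n -> l <= 2 * w + 6 ->
  (l * (u + 1) - u * (2 * w - b)) / v <= 9 * S + 3 * (u / n * z).
Proof.
move=> u1 un w1 wn bn lle.
have n0 : 0 < n by lra.
have v0 : 0 < v by rewrite /v; lra.
have [u0 w0] : 0 <= u /\ 0 <= w by split; lra.
have nV0 : 0 <= n^-1 by rewrite invr_ge0 ltW.
have a0 : 0 <= u / n by exact: mulr_ge0.
have w2n0 : 0 <= w ^+ 2 / n by apply: mulr_ge0 => //; exact: exprn_ge0.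
have wn0 : 0 <= w / n by exact: mulr_ge0.
have h1 : u * (l - (2 * w - b)) <= u * (6 + w ^+ 2 / n).
  by apply: ler_wpM2l => //; move: bn lle; clear_bool; lra.
have h2 : 0 <= u * (6 + w ^+ 2 / n) by apply: mulr_ge0 => //; exact: addr_ge0.
apply: (@le_trans _ _ ((8 * w + u * (6 + w ^+ 2 / n)) / v)).
  apply: ler_wpM2r; first by rewrite invr_ge0 ltW.
  by move: h1 lle w1; clear_bool; lra.
apply: (@le_trans _ _ ((8 * w + u * (6 + w ^+ 2 / n)) / (9 / 10 * n))).
  apply: ler_wpM2l; first by move: h2 w0; clear_bool; lra.
  by rewrite lef_pV2 ?posrE // /v; lra.
have -> : (8 * w + u * (6 + w ^+ 2 / n)) / (9 / 10 * n) =
    10 / 9 * (8 * (w / n) + 6 * (u / n) + u / n * (w ^+ 2 / n)).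
  by field; rewrite gt_eqF.
have : 0 <= u / n * (w ^+ 2 / n) by exact: mulr_ge0.
have : 0 <= u / n * z by apply: mulr_ge0 => //; exact: mulr_ge0 (mulr_ge0 _ _) _.
by rewrite remainderE ?gt_eqF //; move: a0 wn0; clear_bool; lra.
Qed.

(** The opposite difference of exponents. Both are compared with (2w - b) u/(n + w); the excess
    carries the factor (w - b + u)/(n - w + b - u), of order (w + u)/n. *)
Lemma log_diff_le2 (b l : R) : 1 <= u -> u <= n / 10 -> 1 <= w -> w <= n / 10 ->
  0 <= b -> b <= w -> 2 * w <= l ->
  n * (u * (2 * w - b) / ((n + w) * (n - w + b - u))) - l * ((u + 1) / (n + w + 1)) <=
  9 * S + 3 * (u / n * z).
Proof.
move=> u1 un w1 wn b0 bw lge.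
have n0 : 0 < n by lra.
have B0 : 0 < n + w by lra.
have G0 : 0 < n + w + 1 by lra.
have A0 : 0 < n - w + b - u by lra.
have [u0 w0] : 0 <= u /\ 0 <= w by split; lra.
have nV0 : 0 <= n^-1 by rewrite invr_ge0 ltW.
have BV0 : 0 <= (n + w)^-1 by rewrite invr_ge0 ltW.
have a0 : 0 <= u / n by exact: mulr_ge0.
have uB0 : 0 <= u / (n + w) by exact: mulr_ge0.
have w2n0 : 0 <= w ^+ 2 / n by apply: mulr_ge0 => //; exact: exprn_ge0.
have wn0 : 0 <= w / n by exact: mulr_ge0.
have de0 : 0 <= 2 * w - b by lra.
have uB : u / (n + w) <= (u + 1) / (n + w + 1).
  rewrite ler_pdivrMr // [_ / _ * (n + w)]mulrAC ler_pdivlMr //.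
  by move: un w0 n0; clear_bool; lra.
have Xge : (2 * w - b) * (u / (n + w)) <= l * ((u + 1) / (n + w + 1)).
  by apply: ler_pM => //; move: b0 lge; clear_bool; lra.
apply: (@le_trans _ _ (u / (n + w) * (2 * w - b) * ((w - b + u) / (n - w + b - u)))).
  have -> : u / (n + w) * (2 * w - b) * ((w - b + u) / (n - w + b - u)) =
      n * (u * (2 * w - b) / ((n + w) * (n - w + b - u))) - (2 * w - b) * (u / (n + w)).
    by field; rewrite !gt_eqF.
  by rewrite lerD2l lerN2.
apply: (@le_trans _ _ (u / n * (2 * w) * ((w + u) / (8 / 10 * n)))).
  apply: ler_pM.
  - exact: mulr_ge0.
  - by apply: divr_ge0; [move: bw u0; clear_bool; lra | exact: ltW].
  - apply: ler_pM => //; last by move: b0; clear_bool; lra.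
    by apply: ler_wpM2l => //; rewrite lef_pV2 ?posrE //; move: w0; clear_bool; lra.
  - apply: ler_pM; rewrite ?invr_ge0.
    + by move: bw u0; clear_bool; lra.
    + exact: ltW.
    + by move: b0; clear_bool; lra.
    + by rewrite lef_pV2 ?posrE //; move: n0 un wn b0; clear_bool; lra.
have -> : u / n * (2 * w) * ((w + u) / (8 / 10 * n)) =
    5 / 2 * (u / n * (w ^+ 2 / n) + u / n * z).
  by rewrite /z; field; rewrite gt_eqF.
have : 0 <= u / n * (w ^+ 2 / n) by exact: mulr_ge0.
have : 0 <= u / n * z by apply: mulr_ge0 => //; exact: mulr_ge0 (mulr_ge0 _ _) _.
by rewrite remainderE ?gt_eqF //; move: a0 wn0; clear_bool; lra.
Qed.

(** Since b <= w^2/n <= w/10, the factor 2w - b is at least 19w/10. *)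
Lemma exponent_le_reflection (b : R) : 1 <= u -> u <= n / 10 -> 1 <= w -> w <= n / 10 ->
  0 <= b -> b <= w -> b * n <= w ^+ 2 ->
  3 / 2 * y <= n * (u * (2 * w - b) / ((n - w + b) * v)).
Proof.
move=> u1 un w1 wn b0 bw bn.
have n0 : 0 < n by lra.
have v0 : 0 < v by rewrite /v; lra.
have A0 : 0 < n - w + b by lra.
have [u0 w0] : 0 <= u /\ 0 <= w by split; lra.
have de2 : 19 / 10 * w <= 2 * w - b.
  have : b * n <= w * (n / 10) by apply: (le_trans bn); rewrite expr2; apply: ler_wpM2l.
  have -> : w * (n / 10) = (w / 10) * n by ring.
  by rewrite ler_pM2r //; clear_bool; lra.
have q0 : 0 <= u * (2 * w - b) / v.
  by apply: divr_ge0; [apply: mulr_ge0 => //; move: bw w0; clear_bool; lra | exact: ltW].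
have -> : n * (u * (2 * w - b) / ((n - w + b) * v)) =
    n / (n - w + b) * (u * (2 * w - b) / v) by field; rewrite !gt_eqF.
apply: (@le_trans _ _ (1 * (u * (2 * w - b) / v))); last first.
  by apply: ler_wpM2r => //; rewrite ler_pdivlMr ?mul1r //; move: bw; clear_bool; lra.
rewrite mul1r /y mulrA; apply: ler_wpM2r; first by rewrite invr_ge0 ltW.
have : u * (19 / 10 * w) <= u * (2 * w - b) by exact: ler_wpM2l.
by have := mulr_ge0 u0 w0; clear_bool; lra.
Qed.

End Remainder.

(** Both powers are written as e^(-X) and e^(-Y) with X, Y >= 3y/2, where y = uw/v. Bounding |X - Y|
    and applying [absorb] gives the constant 9 + 33/5 <= 16. *)
Lemma reflection_terms_close (R : realType) (n L : nat) (u w b : R) :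
  1 <= u -> u <= n%:R / 10 -> 1 <= w -> w <= n%:R / 10 ->
  0 <= b -> b <= w -> b * n%:R <= w ^+ 2 -> 2 * w <= L%:R -> L%:R <= 2 * w + 6 ->
  forall v : R, v = n%:R + w - u ->
  `| (v / (n%:R + w + 1)) ^+ L - (1 - u * (2 * w - b) / ((n%:R - w + b) * v)) ^+ n | <=
  16 * ((u + w) / n%:R + u * w ^+ 2 / n%:R ^+ 2) * expR (- (u * w / v)).
Proof.
move=> u1 un w1 wn b0 bw bn Lge Lle _ ->; set v := n%:R + w - u.
have n0 : 0 < n%:R :> R by lra.
have v0 : 0 < v by rewrite /v; lra.
have G0 : 0 < n%:R + w + 1 by lra.
have A0 : 0 < n%:R - w + b by lra.
have B0 : 0 < n%:R + w by lra.
have Au0 : 0 < n%:R - w + b - u by lra.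
have vG : v <= n%:R + w + 1 by rewrite /v; lra.
have r0 : 0 < v / (n%:R + w + 1) by exact: divr_gt0.
(* The base of the second power is x2/y2, because y2 - x2 = u (2w - b). *)
pose x2 := (n%:R - w + b - u) * (n%:R + w).
pose y2 := (n%:R - w + b) * v.
have x20 : 0 < x2 by exact: mulr_gt0.
have y20 : 0 < y2 by exact: mulr_gt0.
have yx : y2 - x2 = u * (2 * w - b) by rewrite /y2 /x2 /v; ring.
have xy2 : x2 <= y2.
  by rewrite -subr_ge0 yx; apply: mulr_ge0; move: u1 bw w1; clear_bool; lra.
have -> : 1 - u * (2 * w - b) / y2 = x2 / y2 by rewrite -yx; field; rewrite gt_eqF.
have rr0 : 0 < x2 / y2 by exact: divr_gt0.
have [X1 X2] := negln_ratio_bounds _ _ _ v0 vG.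
have [Y1 Y2] := negln_ratio_bounds _ _ _ x20 xy2.
rewrite yx in Y1 Y2.
have Gv : n%:R + w + 1 - v = u + 1 by rewrite /v; ring.
rewrite Gv in X1 X2.
have powE (x : R) (l : nat) : 0 < x -> x ^+ l = expR (- (l%:R * - ln x)).
  by move=> x0; rewrite mulrN opprK mulr_natl -lnXn // lnK // posrE exprn_gt0.
rewrite (powE _ L r0) (powE _ n rr0).
have {X1}X1 := ler_wpM2l (ler0n _ L) X1; have {X2}X2 := ler_wpM2l (ler0n _ L) X2.
have {Y1}Y1 := ler_wpM2l (ler0n _ n) Y1; have {Y2}Y2 := ler_wpM2l (ler0n _ n) Y2.
move: X1 X2 Y1 Y2; set X := L%:R * - ln _; set Y := n%:R * - ln _ => X1 X2 Y1 Y2.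
have w0 : 0 <= w by lra.
have mX : 3 / 2 * (u * w / v) <= X.
  apply: (le_trans (exponent_le _ _ _ _ u1 un w1 wn)); apply: le_trans X1.
  apply: ler_pM => //; [exact: mulr_ge0 | by apply: divr_ge0; [lra | exact: ltW] |].
  by rewrite ler_pM2r ?invr_gt0 // lerDl.
have mY : 3 / 2 * (u * w / v) <= Y.
  exact: le_trans (exponent_le_reflection _ _ _ _ _ u1 un w1 wn b0 bw bn) Y1.
have bn' : b <= w ^+ 2 / n%:R by rewrite ler_pdivlMr.
have uv : u * (2 * w - b) / v <= Y.
  apply: le_trans Y1.
  have -> : n%:R * (u * (2 * w - b) / y2) = n%:R / (n%:R - w + b) * (u * (2 * w - b) / v).
    by rewrite /y2; field; rewrite !gt_eqF.
  rewrite -[X in X <= _]mul1r; apply: ler_wpM2r.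
    by apply: divr_ge0; rewrite ?(ltW v0) // -yx subr_ge0.
  by rewrite ler_pdivlMr ?mul1r //; move: bw; clear_bool; lra.
have D1 := log_diff_le1 _ _ _ _ _ _ u1 un w1 wn bn' Lle.
have D2 := log_diff_le2 _ _ _ _ _ _ u1 un w1 wn b0 bw Lge.
set D := 9 * _ + 3 * _ in D1 D2.
have XY : X - Y <= D.
  apply: le_trans D1; rewrite -/v mulrBl -mulrA; apply: lerB => //.
have YX : Y - X <= D.
  apply: le_trans D2; apply: lerB => //; apply: (le_trans Y2).
  by rewrite /x2 [(n%:R + w) * _]mulrC.
apply: (le_trans (expR_dist_le _ _ _ _ _ mX mY XY YX)).
apply: (le_trans (absorb _ _ _ _ _ _ u1 un w1 wn (ler0n _ 9) (ler0n _ 3))).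
apply: ler_wpM2r; first exact: expR_ge0.
apply: ler_wpM2r; last by lra.
apply: addr_ge0; apply: divr_ge0; rewrite ?exprn_ge0 ?(ltW n0) //; first by lra.
by apply: mulr_ge0; [lra | exact: exprn_ge0].
Qed.

Lemma small_mesh (R : realType) (v B e : R) : 0 < v -> 0 < e ->
  exists N : nat, [/\ 0 < N%:R :> R, v / N%:R <= 1 / 2 & B * (v / N%:R) <= e].
Proof.
move=> v0 e0.
have Be0 : 0 <= `|B| * v / e by apply: divr_ge0; [apply: mulr_ge0 => //|]; exact: ltW.
have x0 : 0 <= 2 * v + `|B| * v / e by lra.
have xN := archi_boundP x0; set N := Num.Def.archi_bound _ in xN.
have N0 : 0 < N%:R :> R by exact: le_lt_trans xN.
exists N; split=> //.
  by rewrite ler_pdivrMr //; move: xN Be0; clear; lra.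
apply: (@le_trans _ _ (`|B| * (v / N%:R))).
  by apply: ler_wpM2r; [apply: divr_ge0; exact: ltW | exact: ler_norm].
rewrite mulrA ler_pdivrMr // [e * _]mulrC -ler_pdivrMr //.
by move: xN v0; clear; lra.
Qed.

Lemma norm_sandwich (R : realType) (lo hi q a D : R) : lo <= q -> q <= hi ->
  `|lo - 1 + a| <= D -> `|hi - 1 + a| <= D -> `|q - 1 + a| <= D.
Proof.
by rewrite !ler_norml => loq qhi /andP[? ?] /andP[? ?]; apply/andP; split; lra.
Qed.

Lemma combine_bounds (R : realType) (q a b c F S e : R) : 0 <= c ->
  `|q - 1 + a| <= c * F -> F <= 13 * S * e -> `|a - b| <= 16 * S * e ->
  `|q - 1 + b| <= (c * 13 + 16) * S * e.
Proof.
move=> c0 qa FS ab.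
have -> : q - 1 + b = (q - 1 + a) - (a - b) by ring.
apply: (le_trans (ler_normB _ _)).
have := ler_wpM2l c0 FS.
by move: qa ab; clear; lra.
Qed.

(** * Discretisation of the probability *)

Lemma content_bigsetU_le d (T : measurableType d) (K : realType) (P : probability T K)
  (I : Type) (s : seq I) (c : pred I) (F : I -> set T) :
  (forall i, measurable (F i)) ->
  (P (\big[setU/set0]_(i <- s | c i) F i) <= \sum_(i <- s | c i) P (F i))%E.
Proof.
move=> mF; elim: s => [|a s IH]; first by rewrite !big_nil measure0.
rewrite !big_cons; case: (c a) => //.
apply: le_trans; first by apply: measureU2 => //; exact: bigsetU_measurable.
exact: leeD2l.
Qed.

Lemma in_bigsetU (T : Type) (I : finType) (c : pred I) (F : I -> set T) (x : T) :
  (exists2 i, c i & F i x) -> (\big[setU/set0]_(i | c i) F i) x.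
Proof. by move=> [i ci Fi]; rewrite -bigcup_seq_cond; exists i => //=; rewrite mem_index_enum. Qed.

Section Cells.
Variable N : nat.

(* The cells of the unit interval, numbered from right to left; the two extreme
   ones are extended to infinity so that the cells cover the line. *)
Definition cell (k : nat) : interval R :=
  Interval (if k.+1 == N then -oo%O else BRight (1 - k.+1%:R / N%:R))
           (if k == 0%N then +oo%O else BRight (1 - k%:R / N%:R)).

Lemma in_cellE (k : nat) (x : R) : (x \in cell k) =
  ((k.+1 == N) || (1 - k.+1%:R / N%:R < x)) && ((k == 0%N) || (x <= 1 - k%:R / N%:R)).
Proof. by rewrite itv_boundlr /cell; case: ifP; case: ifP. Qed.

Lemma cell_cover (x : R) : (0 < N)%N -> exists k : 'I_N, x \in cell k.
Proof.
move=> N0.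
pose p k := (k.+1 == N) || (1 - k.+1%:R / N%:R < x).
have pN : exists k, p k by exists N.-1; rewrite /p prednK // eqxx.
case: (ex_minnP pN) => k pk kmin.
have kN : (k < N)%N.
  by rewrite -(prednK N0) ltnS; apply: kmin; rewrite /p prednK // eqxx.
exists (Ordinal kN); rewrite in_cellE /=; apply/andP; split; first exact: pk.
case: k pk kmin kN => // k pk kmin kN.
rewrite leNgt /=; apply/negP => lt.
by have := kmin k; rewrite /p lt orbT ltnn => /(_ isT).
Qed.

Lemma lebesgue_cell (k : nat) : (k < N)%N ->
  (@lebesgue_measure R) ([set` cell k]%classic `&` `[0, 1]%classic)%classic = (N%:R^-1)%:E.
Proof.
move=> kN.
have N0 : 0 < N%:R :> R by rewrite ltr0n (leq_ltn_trans _ kN).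
have kN' : (k.+1%:R : R) <= N%:R by rewrite ler_nat.
have kS : (k.+1%:R : R) = k%:R + 1 by rewrite -natr1.
have k0 : (0 : R) <= k%:R by [].
have a0 : 0 <= 1 - k.+1%:R / N%:R :> R by rewrite subr_ge0 ler_pdivrMr ?mul1r.
have ab : 1 - k.+1%:R / N%:R < 1 - k%:R / N%:R :> R.
  by rewrite ltrD2l ltrN2 ltr_pM2r ?invr_gt0 // ltr_nat.
have b1 : 1 - k%:R / N%:R <= 1 :> R by rewrite gerBl divr_ge0.
have len : 1 - k%:R / N%:R - (1 - k.+1%:R / N%:R) = N%:R^-1 :> R by rewrite kS; field; lra.
have -> : ([set` cell k] `&` `[0, 1])%classic =
  [set` Interval (if k.+1 == N then BLeft 0 else BRight (1 - k.+1%:R / N%:R))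
      (BRight (1 - k%:R / N%:R))]%classic.
  have iE x : x \in Interval (if k.+1 == N then BLeft 0 else BRight (1 - k.+1%:R / N%:R))
      (BRight (1 - k%:R / N%:R)) =
      (if k.+1 == N then 0 <= x else 1 - k.+1%:R / N%:R < x) && (x <= 1 - k%:R / N%:R).
    by rewrite itv_boundlr; case: ifP.
  apply/seteqP; split => x /=; rewrite in_cellE iE in_itv /=.
    move=> [/andP[h1 h2] /andP[h3 h4]]; apply/andP; split.
      by case: eqP h1.
    case/orP: h2 => // /eqP k00; apply: (le_trans h4).
    by rewrite k00 mul0r subr0.
  move=> /andP[h1 h2].
  have x1 : x <= 1 := le_trans h2 b1.
  have xa : 0 <= x.
    by move: h1; case: ifP => // _ h1; apply: ltW; apply: le_lt_trans h1.
  by rewrite h2 orbT andbT xa x1; split => //; move: h1; case: ifP.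
rewrite lebesgue_measure_itv /=; case: eqP => kE /=.
  have e0 : 1 - k.+1%:R / N%:R = 0 :> R by rewrite kE divff ?subrr // gt_eqF.
  have bE : 1 - k%:R / N%:R = N%:R^-1 :> R by move: len; rewrite e0 subr0.
  by rewrite bE lte_fin invr_gt0 N0 -EFinB subr0.
by rewrite lte_fin ab -EFinD len.
Qed.

End Cells.

Section Sandwich.
Variables (d : measure_display) (T : measurableType d) (P : probability T R).
Variables (n N : nat) (U : 'I_n -> {RV P >-> measurableTypeR R}) (u v w : R).
Hypotheses (indep : mutually_independent P (fun i => U i : T -> R)).
Hypotheses (unif : forall i, uniform01 P (U i)).
Hypotheses (n0 : (0 < n)%N) (N0 : (0 < N)%N).
Hypotheses (u0 : 0 <= u) (v0 : 0 < v) (vE : v + u = n%:R + w) (w0 : 0 <= w).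

Let h := v / N%:R.
Let count (x : T) (t : R) := #|[set i : 'I_n | U i x <= t]%SET|.
Let E : set T := [set x | forall t : R, 0 <= t <= 1 -> (count x t)%:R <= v * t + u]%classic.

Lemma QnE : Qn P (fun i => U i : T -> R) u v = fine (P E).
Proof.
rewrite /Qn; congr (fine (P _)); apply/seteqP; split => x /= H t t01.
all: have := H t t01; rewrite /empirical_cdf RdivE.
all: have -> : #|[set i : 'I_n | (U i x : R) <= t]%classic| = count x t
  by rewrite /count; apply: eq_card => i; rewrite inE; apply/idP/idP; rewrite in_setE.
all: by rewrite ler_pM2r // invr_gt0 ltr0n.
Qed.

(** The uncountable condition on t reduces to finitely many: a violation at t means that some set J
    of points lies at or below t with t < (|J| - u)/v, and the least possible t is the maximum of 0
    and the points of J. *)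
Lemma measurable_E : measurable E.
Proof.
pose c (J : {set 'I_n}) : R := (#|J|%:R - u) / v.
pose G (J : {set 'I_n}) : set T :=
  (\big[setI/setT]_(j in J) (U j @^-1` [set` Interval -oo%O (BRight (1 : R))] `&`
                             U j @^-1` [set` Interval -oo%O (BLeft (c J))]))%classic.
suff -> : E = (~` (\big[setU/set0]_(J : {set 'I_n} | 0 < c J) G J))%classic.
  apply: measurableC; apply: bigsetU_measurable => J _; apply: bigsetI_measurable => j _.
  by apply: measurableI; apply: measurable_funPTI; exact: measurable_itv.
have GE J x : G J x <-> forall j, j \in J -> U j x <= 1 /\ U j x < c J.
  rewrite /G -bigcap_seq_cond; split => [H j jJ|H j].
    by have [] := H j; rewrite /= ?mem_index_enum ?jJ // !in_itv.
  by move=> /= /andP[_ jJ]; rewrite /= !in_itv /=; exact: H.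
apply/seteqP; split => x /=.
  move=> Ex; rewrite -bigcup_seq_cond => -[J /= /andP[_ cJ] /GE GJ].
  pose t : R := \big[Num.max/0]_(j in J) U j x.
  have tc : t < c J by apply/bigmax_ltP; split => // j /GJ[].
  have t1 : t <= 1 by apply/bigmax_leP; split => // j /GJ[].
  have t0 : 0 <= t by exact: bigmax_ge_id.
  have := Ex t; rewrite t0 t1 => /(_ isT).
  have : #|J|%:R <= (count x t)%:R :> R.
    rewrite ler_nat subset_leq_card //; apply/fintype.subsetP => j jJ.
    by rewrite inE; apply: le_bigmax_cond.
  move: tc; rewrite /c ltr_pdivlMr //.
  by rewrite mulrC => ? ? ?; lra.
move=> H t /andP[t0 t1]; rewrite leNgt; apply/negP => lt; apply: H.
apply: in_bigsetU; pose J : {set 'I_n} := [set i : 'I_n | U i x <= t]%SET.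
have tc : t < c J by rewrite /c ltr_pdivlMr // mulrC; rewrite /count -/J in lt; lra.
exists J; first by apply: le_lt_trans tc.
apply/GE => j; rewrite inE => jt; split; first exact: le_trans t1.
exact: le_lt_trans tc.
Qed.

Let ev (s : {ffun 'I_n -> 'I_N}) : set T :=
  (\bigcap_(i in [set j | j \in [set: 'I_n]%SET]) (U i @^-1` [set` cell N (s i)]))%classic.

Lemma evE s x : ev s x <-> forall i, (U i x : R) \in cell N (s i).
Proof. by split => [H i|H i _]; [apply: (H i) => /=; rewrite inE | exact: H]. Qed.

Lemma measurable_ev s : measurable (ev s).
Proof.
apply: fin_bigcap_measurable; first exact: finite_finset.
by move=> i _; apply: measurable_funPTI; exact: measurable_itv.
Qed.

Lemma P_ev s : P (ev s) = ((N%:R^-1) ^+ n)%:E.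
Proof.
rewrite (indep [set: 'I_n]%SET (fun i => [set` cell N (s i)]%classic)); last first.
  by move=> i; exact: measurable_itv.
rewrite (eq_bigr (fun _ => (N%:R^-1 : R)%:E)); last first.
  by move=> i _; rewrite unif ?lebesgue_cell //; exact: measurable_itv.
by rewrite prodEFin prodr_const cardsT card_ord.
Qed.

Lemma ev_cover x : exists s, ev s x.
Proof.
have H i : exists k : 'I_N, (U i x : R) \in cell N k by exact: cell_cover.
exists [ffun i => xchoose (H i)]; apply/evE => i; rewrite ffunE.
exact: (xchooseP (H i)).
Qed.

Lemma card_below s k : #|below n N k s| = (n - #|[set i | k <= s i]%N|)%N.
Proof.
have -> : [set i | k <= s i]%N%SET = (~: below n N k s)%SET.
  by apply/setP => i; rewrite !inE leqNgt.
by rewrite [LHS]cardsCs card_ord.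
Qed.

Let ok (c : R) (k m : nat) := k%:R * h <= m%:R + c.
Let good (c : R) (s : {ffun 'I_n -> 'I_N}) := [forall l : 'I_N, ok c l.+1 #|below n N l.+1 s|].

Lemma card_split s k : (#|below n N k s|%:R : R) = n%:R - #|[set i | k <= s i]%N|%:R.
Proof. by rewrite card_below natrB // -[X in (_ <= X)%N](card_ord n) max_card. Qed.

(** Evaluate the constraint at the cell end points t = 1 - k/N: every point in a cell numbered k or
    more is at most t, and n - (v t + u) = k h - w. *)
Lemma E_good s x : ev s x -> E x -> good w s.
Proof.
move=> /evE sx Ex; apply/forallP => l; rewrite /ok card_split.
set k := l.+1.
have NR0 : 0 < N%:R :> R by rewrite ltr0n.
have kN : (k <= N)%N by exact: ltn_ord.
have kN' : (k%:R : R) / N%:R <= 1 by rewrite ler_pdivrMr // mul1r ler_nat.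
have k0 : 0 <= (k%:R : R) / N%:R by rewrite divr_ge0.
have := Ex (1 - k%:R / N%:R).
rewrite subr_ge0 kN' gerBl k0 => /(_ isT) le1.
have : #|[set i | k <= s i]%N|%:R <= (count x (1 - k%:R / N%:R))%:R :> R.
  rewrite ler_nat subset_leq_card //; apply/fintype.subsetP => i; rewrite !inE => ki.
  have := sx i; rewrite in_cellE => /andP[_].
  rewrite gtn_eqF /=; last exact: leq_trans ki.
  move=> /le_trans; apply; rewrite lerD2l lerN2 ler_pM2r ?invr_gt0 // ler_nat //.
rewrite /h; move: le1; rewrite mulrBr mulr1.
have -> : k%:R * (v / N%:R) = v * (k%:R / N%:R) by ring.
by have := vE; lra.
Qed.

(** Among the points at most t take one in the rightmost cell, number k. All such points lie in
    cells numbered k or more, while t >= 1 - (k + 1)/N; the offset of one cell is paid by lowering w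
    to w - h. *)
Lemma good_E s x : h <= w -> ev s x -> good (w - h) s -> E x.
Proof.
move=> hw /evE sx /forallP gs t /andP[t0 t1].
have NR0 : 0 < N%:R :> R by rewrite ltr0n.
case: (pickP (fun i : 'I_n => U i x <= t)) => [i0 i0t|none]; last first.
  rewrite /count (_ : [set i : 'I_n | U i x <= t]%SET = finset.set0) ?cards0.
    by rewrite addr_ge0 // mulr_ge0 // ltW.
  by apply/setP => i; rewrite !inE none.
pose j := [arg min_(i < i0 | U i x <= t) (s i : nat)].
have [jt jmin] : (U j x <= t) /\ forall i, U i x <= t -> (s j <= s i)%N.
  by rewrite /j; case: arg_minnP => // i it im; split.
pose k : nat := s j.
have okk : k%:R * h <= #|below n N k s|%:R + (w - h).
  (* [good] speaks of k >= 1 only; for k = 0 the inequality is h <= w. *)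
  case: (posnP k) => [->|kpos]; first by rewrite mul0r addr_ge0 // subr_ge0.
  have lk : (k.-1 < N)%N by rewrite prednK //; apply: ltnW; exact: ltn_ord.
  by have := gs (Ordinal lk); rewrite /ok /= prednK.
have tk : 1 - k.+1%:R / N%:R <= t.
  have := sx j; rewrite in_cellE -/k => /andP[/orP[/eqP ->|lt] _].
    by rewrite divff ?subrr // gt_eqF.
  by apply: (le_trans (ltW lt)).
have : (count x t)%:R <= #|[set i | k <= s i]%N|%:R :> R.
  rewrite ler_nat subset_leq_card //; apply/fintype.subsetP => i; rewrite !inE.
  exact: jmin.
have : v * (1 - k.+1%:R / N%:R) <= v * t by rewrite ler_pM2l.
rewrite mulrBr mulr1.
have -> : v * (k.+1%:R / N%:R) = k%:R * h + h.
  by rewrite -natr1 /h; ring.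
by move: okk; rewrite card_split; have := vE; lra.
Qed.

Lemma P_good_ev (c : pred {ffun 'I_n -> 'I_N}) :
  (P (\big[setU/set0]_(s | c s) ev s)%classic <= (#|[set s | c s]%SET|%:R * N%:R^-1 ^+ n)%:E)%E.
Proof.
apply: le_trans; first by apply: content_bigsetU_le => s; exact: measurable_ev.
rewrite (eq_bigr (fun _ => ((N%:R^-1) ^+ n)%:E)); last by move=> s _; exact: P_ev.
rewrite sumEFin lee_fin sumr_const mulr_natl.
by rewrite (eq_card (B := [set s | c s]%SET)) // => s; rewrite inE.
Qed.

Lemma good_count c : #|[set s | good c s]%SET|%:R * N%:R^-1 ^+ n = Dk R h c N n / qp R n v.
Proof.
have NR0 : 0 < N%:R :> R by rewrite ltr0n.
have h0 : 0 < h by rewrite /h divr_gt0.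
rewrite /good (card_good (ok c) n N) -nplace_Dk.
have f0 : n`!%:R != 0 :> R by rewrite pnatr_eq0 -lt0n fact_gt0.
have Nn : (N%:R : R) ^+ n != 0 by rewrite expf_neq0 // gt_eqF.
have -> : qp R n h = qp R n v / N%:R ^+ n.
  by rewrite /qp /h expr_div_n; field; rewrite Nn f0.
have qv : qp R n v != 0 by rewrite /qp mulf_neq0 ?invr_neq0 // expf_neq0 // gt_eqF.
by rewrite exprVn /ok; field; rewrite qv Nn.
Qed.

(** Both bounds need only the union bound for the covering events [ev]: the upper one for [E], the
    lower one for its complement, the good and bad placements together having total weight 1. *)
Lemma Qn_sandwich : h <= w ->
  Dk R h (w - h) N n / qp R n v <= Qn P (fun i => U i : T -> R) u v /\
  Qn P (fun i => U i : T -> R) u v <= Dk R h w N n / qp R n v.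
Proof.
move=> hw; rewrite QnE -!good_count.
have mE := measurable_E.
have PEfin : P E \is a fin_num by exact: fin_num_measure.
have mev c : measurable (\big[setU/set0]_(s | (c : pred {ffun 'I_n -> 'I_N}) s) ev s)%classic.
  by apply: bigsetU_measurable => s _; exact: measurable_ev.
have NR0 : 0 < N%:R :> R by rewrite ltr0n.
split; last first.
  rewrite -lee_fin fineK //; apply: le_trans (P_good_ev _).
  apply: le_measure; rewrite ?inE // => x Ex.
  have [s sx] := ev_cover x; apply: in_bigsetU; exists s => //.
  exact: E_good sx Ex.
have : (P (~` E)%classic <= (#|[set s | ~~ good (w - h) s]%SET|%:R * N%:R^-1 ^+ n)%:E)%E.
  apply: le_trans (P_good_ev _).
  apply: le_measure; rewrite ?inE //; first exact: measurableC.
  move=> x nEx.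
  have [s sx] := ev_cover x; apply: in_bigsetU; exists s => //.
  by apply/negP => gs; apply: nEx; exact: good_E sx gs.
rewrite probability_setC // -(fineK PEfin) -EFinB lee_fin.
have : #|[set s | good (w - h) s]%SET|%:R * N%:R^-1 ^+ n +
       #|[set s | ~~ good (w - h) s]%SET|%:R * N%:R^-1 ^+ n = 1 :> R.
  rewrite -mulrDl -natrD.
  have -> : [set s | ~~ good (w - h) s]%SET = (~: [set s | good (w - h) s])%SET.
    by apply/setP => s; rewrite !inE.
  rewrite cardsC card_ffun !card_ord natrX exprVn divff // expf_neq0 // gt_eqF //.
by lra.
Qed.

End Sandwich.

(** * Choice of L, limit of vanishing mesh and assembly *)

Theorem theorem2 :
  exists C : R, 0 < C /\
  forall (n : nat) (u w : R),
    leq 1 n -> 1 <= u <= n%:R / 10 -> 1 <= w <= n%:R / 10 ->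
    forall (d : measure_display) (T : measurableType d) (P : probability T R)
           (U : 'I_n -> {RV P >-> measurableTypeR R}),
      mutually_independent P (fun i => U i : T -> R) ->
      (forall i, uniform01 P (U i)) ->
      forall b : R, 0 <= b <= w ->
        fm n.+1 (1 - w) = fm n.+1 (1 + w - b) ->
        `| Qn P (fun i => U i : T -> R) u (n%:R + w - u) - 1
           + (1 - u * (2 * w - b) / ((n%:R - w + b) * (n%:R + w - u))) ^+ n |
        <= C * ((u + w) / n%:R + u * w ^+ 2 / n%:R ^+ 2)
             * expR (- (u * w / (n%:R + w - u))).
Proof.
have [c [c0 bound]] := discrete_bound R.
exists (c * 13 + 16); split; first by lra.
move=> n u w n0 /andP[u1 un] /andP[w1 wn] d T P U indep unif b /andP[b0 bw] fE.
have nR : 10 <= n%:R :> R by lra.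
(* In f_(n+1) the exponent is n, and n + 1 minus the argument is n + w on one side and n - w + b on
   the other. *)
have bn : b * n%:R <= w ^+ 2.
  apply: (@reflection_defect_le R n) => //; first by lra.
  move: fE; rewrite /fm -natr1 !ifT; [|lra|lra].
  have -> : n%:R + 1 - (1 - w) = n%:R + w by ring.
  by have -> : n%:R + 1 - (1 + w - b) = n%:R - w + b by ring.
(* This puts L = K + 2 between 2w + 5 and 2w + 6. *)
pose K := (Num.truncn (2 * w) + 4)%N.
have [Kge Kle] : 2 * w + 3 <= K%:R /\ K%:R <= 2 * w + 4.
  have w20 : 0 <= 2 * w by lra.
  have /andP[t1 t2] := truncn_itv w20.
  by rewrite /K natrD; move: t2; rewrite -natr1; lra.
set v := n%:R + w - u.
have v0 : 0 < v by rewrite /v; lra.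
set S := (u + w) / n%:R + _.
set Q := Qn _ _ _ _.
have := bound n u w K u1 un w1 wn Kge Kle.
rewrite /= -/v; set r := v / _ => -[B HB].
have rem : r ^+ K * (w / n%:R + (2 + w ^+ 2 / n%:R) * (1 - r) + w * (1 - r) ^+ 2) <=
    13 * S * expR (- (u * w / v)).
  by apply: remainder_le => //; lra.
set F := r ^+ K * _ in rem HB.
have close : `|r ^+ K.+2 - (1 - u * (2 * w - b) / ((n%:R - w + b) * v)) ^+ n| <=
    16 * S * expR (- (u * w / v)).
  by apply: reflection_terms_close => //; rewrite -addn2 natrD; lra.
(* For each e > 0 the mesh is taken so fine that B h <= e; the offsets th = h and th = 0 give the
   lower and the upper side of the sandwich. *)
have main : `|Q - 1 + r ^+ K.+2| <= c * F.
  apply/ler_addgt0Pr => e e0.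
  have [N [NR0 h12 Bh]] := small_mesh _ v B e v0 e0.
  have N0 : (0 < N)%N by rewrite ltr0n in NR0.
  have h0 : 0 < v / N%:R by exact: divr_gt0.
  have hw : v / N%:R <= w by apply: (le_trans h12); move: w1; clear; lra.
  have vh : v = N%:R * (v / N%:R) by rewrite mulrC divfK // gt_eqF.
  have vE : v + u = n%:R + w by rewrite /v subrK.
  have u0 : 0 <= u by exact: le_trans u1.
  have [lo hi] := Qn_sandwich _ _ P n N U u v w indep unif n0 N0 u0 v0 vE hw.
  have bl := HB N _ _ vh h0 h12 (ltW h0) (lexx _).
  have bh := HB N _ _ vh h0 h12 (lexx _) (ltW h0).
  rewrite subr0 in bh.
  apply: (le_trans (norm_sandwich _ _ _ _ _ _ lo hi bl bh)).
  by rewrite lerD2l.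
exact: combine_bounds main rem close.
Qed.
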